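(* There is a positive constant $\Theta$ such that, as $x\to\infty$, $$L(x;\mathrm{id})=\frac{1}{\zeta(2)}x(\log x)^2+\frac{1}{\zeta(2)}\left(2\gamma-3-\frac{\zeta'(2)}{\zeta(2)}\right)x\log x-\frac{1}{\zeta(2)}\left(4\gamma-3-2\frac{\zeta'(2)}{\zeta(2)}+\frac{\zeta'(2)}{2}-\Theta\zeta(3)-\zeta(2)\log\sqrt{2\pi}\right)x+\sum_{n\leq x}\frac{\mu(n)}{n}\Delta\!\left(\frac{x}{n}\right)\log\frac{x}{e}+O\!\left((\log x)^2\right),$$ and $$L(x;\phi)=\frac{1}{\zeta^2(2)}x(\log x)^2+\frac{1}{\zeta^2(2)}\left(2\gamma-3-2\frac{\zeta'(2)}{\zeta(2)}\right)x\log x-\frac{1}{\zeta^2(2)}\left(4\gamma-3-4\frac{\zeta'(2)}{\zeta(2)}+\frac{\zeta'(2)}{2}-\Theta\zeta(3)-\zeta(2)\log\sqrt{2\pi}\right)x+\sum_{n\leq x}\frac{(\mu*\mu)(n)}{n}\Delta\!\left(\frac{x}{n}\right)\log\frac{x}{e}+O\!\left((\log x)^3\right).$$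
   Context: For an arithmetical function $f$ and real $x>1$, $L(x;f):=\sum_{k\le x}\frac1k\sum_{j=1}^{k}f(\gcd(k,j))\log j$ (sum over positive integers $k\le x$). $\mathrm{id}(n)=n$, $\phi$ is Euler's totient function, $\mu$ the Möbius function, and $(f*g)(n)=\sum_{d\mid n}f(d)g(n/d)$ the Dirichlet convolution. $\tau(n)$ is the number of divisors of $n$, and $\Delta(x)$ is defined by $\sum_{n\le x}\tau(n)=x\log x+(2\gamma-1)x+\Delta(x)$. $\zeta$ is the Riemann zeta-function, $\gamma$ the Euler constant. *)

(* Defs.v *)
From mathcomp Require Export all_boot all_order all_algebra.
From mathcomp Require Export all_classical all_reals all_analysis.
Set Implicit Arguments.
Unset Strict Implicit.
Unset Printing Implicit Defensive.
Export Order.TTheory GRing.Theory Num.Theory.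
Export numFieldNormedType.Exports.
Global Open Scope classical_set_scope.
Global Open Scope ring_scope.

Section Defs.
Variable R : realType.

(* An arithmetical function is a map [nat -> R]; only its values at positive
   integers are ever used. *)
Implicit Types (f g : nat -> R) (x s : R) (n : nat).

Definition summatory f x : R := \sum_(1 <= n < (Num.truncn x).+1) f n.

Definition arith_id n : R := n%:R.

Definition arith_phi n : R := (totient n)%:R.

Definition arith_tau n : R := (size (divisors n))%:R.

Definition moebius n : R :=
  if (0 < n)%N && all (fun p => logn p n == 1%N) (primes n)
  then (-1) ^+ size (primes n) else 0.

Definition dirichlet f g n : R :=
  \sum_(d <- divisors n) f d * g (n %/ d)%N.

Definition gcd_log_sum f x : R :=
  summatory (fun k =>
    k%:R^-1 * \sum_(1 <= j < k.+1) f (gcdn k j) * ln j%:R) x.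

Definition euler_gamma : R :=
  limn (fun n => (\sum_(1 <= k < n.+1) k%:R^-1) - ln n%:R : R).

(* The Riemann zeta-function on the real half-line [1 < s], where it is given
   by its Dirichlet series; only values and the derivative there are used. *)
Definition zeta s : R := limn (series (fun n => (n.+1%:R `^ s)^-1 : R)).

Definition dzeta s : R := derive1 zeta s.

Definition divisor_Delta x : R :=
  summatory arith_tau x - (x * ln x + (2 * euler_gamma - 1) * x).

Definition bigO_pinfty (f g : R -> R) : Prop :=
  exists C : R, \forall x \near +oo, `|f x| <= C * `|g x|.

End Defs.

Arguments euler_gamma {R}.
Arguments zeta {R} s.
Arguments dzeta {R} s.

(* Main.v *)
From mathcomp Require Import ring lra zify cyclic.
Require Import Defs.
Set Implicit Arguments.
Unset Strict Implicit.
Unset Printing Implicit Defensive.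

(* If [f0 = f * id * 1] (with [f = mu] for [id] and [f = mu * mu] for [phi]),
   summing over the common divisor of [k] and [j] gives
     L(x; f0) = sum_(n <= x) f(n)/n (ln (x/e) D(x/n) - P(x/n))
                + sum_(n <= x) (f * w)(n)/n floor(x/n),
   where [D] is the summatory function of [tau],
   [P y = sum_(m <= y) tau(m) ln (y/m)] and [w l = ln l! - l ln l + l].
   The hyperbola method gives [P y = y ln y + (2 gamma - 2) y + O(1 + ln y)]:
   unlike [D], this weighted sum has only a logarithmic error.  By Stirling,
   [w = ln / 2 + ln (sqrt (2 pi)) + delta] with [0 <= delta l <= 1/(4 l)], so
   [Theta = zeta(3)^-1 sum_l delta(l)/l^2].  The [ln] part of [w] is convolved
   with [mu] first: [mu * ln] is the von Mangoldt function, and the bound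
   [0 <= mu * ln <= ln] saves the factor [ln x] that is lost if [mu] is
   estimated by [1].  What remains is bookkeeping with truncated Dirichlet
   series at 2, whose tails are [O((ln x)^k / x)]. *)

(** * Dirichlet convolution *)

Section DirichletConvolution.
Variable R : realType.
Implicit Types (u v w f g : nat -> R) (F : nat -> R) (n N : nat).

(** [Delta] is kept in the result and never estimated, so everything else must be accurate to a
    power of the logarithm by itself. For [P] this is possible because [P y] is the integral of
    [D t / t] from 1 to [y]: the weight [ln (y/m)] vanishes at the edge [m = y] and smooths the
    lattice point count under the hyperbola. Both formulas are one statement with a parameter [q], 0
    for [f = mu] and 1 for [f = mu * mu], and an error of order [q + 2] in the logarithm: the sum of
    [|f n| / n] costs [q + 1] logarithms, the error of [P] one more. No cancellation in [mu] enters
    beyond [mu * 1] being the convolution unit; the values at 2 of the series of [mu] and [mu ln]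
    follow from convolution identities and the uniqueness of such values. As [zeta] is just a limit
    of partial sums, [zeta'(2)] is computed from the difference quotient, with a quadratic remainder
    bounded term by term. *)

Lemma sum_divisors_widen n N F : (0 < n <= N)%N ->
  \sum_(d <- divisors n) F d = \sum_(1 <= d < N.+1 | (d %| n)%N) F d.
Proof.
move=> /andP[n0 nN]; rewrite -[RHS]big_filter; apply: perm_big.
apply: uniq_perm => [||d]; [exact: divisors_uniq|exact: filter_uniq (iota_uniq _ _)|].
rewrite -dvdn_divisors// mem_filter mem_index_iota.
case dn: (d %| n)%N => //=; rewrite ltnS (dvdn_gt0 n0 dn)/=.
by rewrite (leq_trans _ nN)// dvdn_leq.
Qed.

Lemma sum_divisors n F : (0 < n)%N ->
  \sum_(d <- divisors n) F d = \sum_(1 <= d < n.+1 | (d %| n)%N) F d.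
Proof.
by move=> n0; rewrite (@sum_divisors_widen _ n)// n0 leqnn.
Qed.

Lemma sum_multiples d N F : (0 < d)%N ->
  \sum_(1 <= k < N.+1 | (d %| k)%N) F k =
  \sum_(1 <= m < (N %/ d).+1) F (d * m)%N.
Proof.
move=> d0; elim: N => [|N IH]; first by rewrite div0n !big_nil.
rewrite big_mkcond big_nat_recr//= -big_mkcond IH divnS//.
case: ifP => dN; last by rewrite add0n addr0.
rewrite add1n [RHS]big_nat_recr//=; congr (_ + F _).
by move: (divnS N d0); rewrite dN add1n => <-; rewrite mulnC divnK.
Qed.

(** Pairs [(n, m)] are grouped by their product. The weight [F] is arbitrary so that this identity
    serves both the algebra of convolution, through [eq_from_sums], and the later double sums. *)
Lemma sum_dirichletE N u v F :
  \sum_(1 <= k < N.+1) dirichlet u v k * F k =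
  \sum_(1 <= n < N.+1) u n * \sum_(1 <= m < (N %/ n).+1) v m * F (n * m)%N.
Proof.
transitivity (\sum_(1 <= k < N.+1) \sum_(1 <= d < N.+1 | (d %| k)%N)
    u d * v (k %/ d)%N * F k).
  apply: eq_big_nat => k /andP[k0 kN].
  rewrite /dirichlet sum_divisors// mulr_suml.
  rewrite [RHS](@big_cat_nat _ _ _ k.+1)//=.
  rewrite [X in _ + X]big1_seq ?addr0// => d /andP[dk].
  rewrite mem_index_iota => /andP[kd _].
  by move: (dvdn_leq k0 dk); rewrite leqNgt kd.
under eq_bigr do rewrite big_mkcond.
rewrite exchange_big; apply: eq_big_nat => d /andP[d0 _].
rewrite -big_mkcond sum_multiples// mulr_sumr; apply: eq_bigr => m _.
by rewrite mulKn// mulrA.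
Qed.

Lemma sum_pairs N (G : nat -> nat -> R) :
  \sum_(1 <= n < N.+1) \sum_(1 <= m < (N %/ n).+1) G n m =
  \sum_(1 <= n < N.+1) \sum_(1 <= m < N.+1 | (n * m <= N)%N) G n m.
Proof.
apply: eq_big_nat => n /andP[n0 nN].
have le : ((N %/ n).+1 <= N.+1)%N by rewrite ltnS leq_div.
rewrite [RHS](@big_cat_nat _ _ _ (N %/ n).+1)//=.
rewrite [X in _ = _ + X]big1_seq ?addr0; last first.
  move=> m /andP[mN]; rewrite mem_index_iota => /andP[+ _].
  by rewrite ltnNge leq_divRL// mulnC mN.
rewrite [RHS]big_nat_cond [LHS]big_nat_cond; apply: eq_bigl => m.
by rewrite andbT ltnS leq_divRL// mulnC -andbA andbb.
Qed.

Lemma sum_pairsC N (G : nat -> nat -> R) :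
  \sum_(1 <= n < N.+1) \sum_(1 <= m < (N %/ n).+1) G n m =
  \sum_(1 <= m < N.+1) \sum_(1 <= n < (N %/ m).+1) G n m.
Proof.
rewrite !sum_pairs; under eq_bigr do rewrite big_mkcond.
rewrite exchange_big; apply: eq_bigr => m _; rewrite -big_mkcond.
by apply: eq_bigl => n; rewrite mulnC.
Qed.

(** The weight can be the indicator of [n]. Testing against weights turns the convolution laws into
    exchanges of nested sums, with no bijections between sets of divisors. *)
Lemma eq_from_sums n f g : (0 < n)%N ->
  (forall F, \sum_(1 <= k < n.+1) f k * F k = \sum_(1 <= k < n.+1) g k * F k) ->
  f n = g n.
Proof.
move=> n0 /(_ (fun k => (k == n)%:R)).
rewrite !big_nat_recr//= eqxx !mulr1 !big1_seq ?add0r//;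
by move=> k; rewrite /= mem_index_iota => /andP[_ kn]; rewrite ltn_eqF ?mulr0.
Qed.

Lemma dirichletC u v n : (0 < n)%N -> dirichlet u v n = dirichlet v u n.
Proof.
move=> n0; apply: eq_from_sums => // F; rewrite !sum_dirichletE.
under eq_bigr do rewrite mulr_sumr.
rewrite sum_pairsC; apply: eq_bigr => m _; rewrite mulr_sumr.
by apply: eq_bigr => k _; rewrite mulnC; ring.
Qed.

Lemma dirichletA u v w n : (0 < n)%N ->
  dirichlet u (dirichlet v w) n = dirichlet (dirichlet u v) w n.
Proof.
move=> n0; apply: eq_from_sums => // F; rewrite !sum_dirichletE.
apply: eq_bigr => a _; congr (_ * _); rewrite sum_dirichletE.
apply: eq_bigr => b _; congr (_ * _); rewrite divnMA.
by apply: eq_bigr => c _; rewrite mulnA.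
Qed.

Lemma eq_dirichlet u u' v v' n : (0 < n)%N ->
  (forall k, (0 < k)%N -> u k = u' k) -> (forall k, (0 < k)%N -> v k = v' k) ->
  dirichlet u v n = dirichlet u' v' n.
Proof.
move=> n0 uu vv; rewrite /dirichlet !sum_divisors// [LHS]big_nat_cond.
rewrite [RHS]big_nat_cond; apply: eq_bigr => d /andP[/andP[d0 _] dn].
by rewrite uu// vv// divn_gt0// dvdn_leq.
Qed.

Lemma dirichletDr u v w n :
  dirichlet u (fun k => v k + w k) n = dirichlet u v n + dirichlet u w n.
Proof. by rewrite /dirichlet -big_split; apply: eq_bigr => d _; rewrite mulrDr. Qed.

Lemma dirichletZr (a : R) u v n :
  dirichlet u (fun k => a * v k) n = a * dirichlet u v n.
Proof. by rewrite /dirichlet mulr_sumr; apply: eq_bigr => d _; ring. Qed.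

Lemma ler_norm_dirichlet u v u' v' n :
  (forall k, (0 < k)%N -> `|u k| <= u' k) ->
  (forall k, (0 < k)%N -> `|v k| <= v' k) -> (0 < n)%N ->
  `|dirichlet u v n| <= dirichlet u' v' n.
Proof.
move=> uu vv n0; rewrite /dirichlet !sum_divisors// big_nat_cond.
rewrite [leRHS]big_nat_cond.
apply: le_trans (ler_norm_sum _ _ _) _; apply: ler_sum => d.
move=> /andP[/andP[d0 _] dn]; rewrite normrM ler_pM//; first exact: uu.
by apply: vv; rewrite divn_gt0// dvdn_leq.
Qed.

Definition dirichlet_unit n : R := (n == 1%N)%:R.

Lemma dirichlet_unitl u n : (0 < n)%N -> dirichlet dirichlet_unit u n = u n.
Proof.
move=> n0; rewrite /dirichlet sum_divisors// big_mkcond big_ltn ?ltnS//= dvd1n.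
rewrite /dirichlet_unit/= mul1r divn1 big1_seq ?addr0// => d /=.
by rewrite mem_index_iota => /andP[d1 _]; rewrite gtn_eqF// mul0r if_same.
Qed.

Lemma dirichlet_unitr u n : (0 < n)%N -> dirichlet u dirichlet_unit n = u n.
Proof. by move=> n0; rewrite dirichletC// dirichlet_unitl. Qed.

Lemma dirichlet_natM u v n : (0 < n)%N ->
  dirichlet (fun k => k%:R * u k) (fun k => k%:R * v k) n = n%:R * dirichlet u v n.
Proof.
move=> n0; rewrite /dirichlet mulr_sumr !sum_divisors// big_mkcond.
rewrite [RHS]big_mkcond; apply: eq_bigr => d _; case: ifP => // dn.
by rewrite -{3}(divnK dn) natrM; ring.
Qed.

Lemma dirichlet11 n : (0 < n)%N ->
  dirichlet (fun=> 1) (fun=> 1) n = arith_tau R n.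
Proof.
by move=> n0; rewrite /dirichlet mulr1 big_const_seq count_predT iter_addr_0.
Qed.

Lemma dirichlet_phi1 n : (0 < n)%N ->
  dirichlet (@arith_phi R) (fun=> 1) n = arith_id R n.
Proof.
move=> n0; rewrite /dirichlet sum_divisors// /arith_id.
rewrite -[in RHS](sum_totient_dvd n) natr_sum 
  -(big_mkord (fun d => d %| n)%N (fun d => (totient d)%:R)).
(* The library sum starts at [d = 0], which does not divide [n > 0]. *)
rewrite [RHS]big_mkcond [RHS]big_ltn//= dvd0n eqn0Ngt n0/= add0r -big_mkcond.
by apply: eq_bigr => d _; rewrite mulr1.
Qed.
End DirichletConvolution.

(** * The Moebius and von Mangoldt functions *)

Section Moebius.
Variable R : realType.
Implicit Types (F : nat -> R) (n N d m p : nat).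
Let mu := moebius R.

Lemma moebius_sqfactor p n : prime p -> (1 < logn p n)%N -> mu n = 0.
Proof.
move=> pp pn; rewrite /mu /moebius; case: ifP => // /andP[n0 /allP/(_ p)].
rewrite -logn_gt0 (ltn_trans _ pn)// => /(_ isT)/eqP pn1.
by rewrite pn1 in pn.
Qed.

Lemma moebius_primeM p n : prime p -> (0 < n)%N -> ~~ (p %| n)%N ->
  mu (p * n) = - mu n.
Proof.
move=> pp n0 pn; have p0 := prime_gt0 pp.
have prm : perm_eq (primes (p * n)) (p :: primes n).
  apply: uniq_perm; first exact: primes_uniq.
    by rewrite /= primes_uniq mem_primes pp n0 (negbTE pn).
  by move=> q; rewrite primesM// primes_prime// !inE.
rewrite /mu /moebius muln_gt0 p0 n0/= (perm_size prm) (perm_all _ prm)/=.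
rewrite lognM// logn_prime// eqxx (_ : logn p n = 0)%N/=; last first.
  by apply/eqP; rewrite -leqn0 leqNgt logn_gt0 mem_primes pp n0.
rewrite (_ : all _ (primes n) = all (fun q => logn q n == 1%N) (primes n)).
  by case: ifP => _; rewrite ?oppr0// exprS mulN1r.
apply: eq_in_all => q; rewrite mem_primes => /and3P[pq _ qn].
rewrite lognM// logn_prime//; case: (eqVneq q p) => [qp|_]//=.
by move: qn; rewrite qp (negbTE pn).
Qed.

Lemma moebius_le1 n : `|mu n| <= 1.
Proof.
rewrite /mu /moebius; case: ifP => _; last by rewrite normr0.
by rewrite normrX normrN1 expr1n.
Qed.

(** A divisor of [m p^(k+1)] on which [mu] does not vanish is [d] or [p d] with [d] dividing [m],
    and [mu (p d) = - mu d]. A constant [F] then gives [mu * 1], and [F] affine in [ln] gives the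
    von Mangoldt function. *)
Lemma sum_moebius_pfactor p m k F : prime p -> (0 < m)%N -> ~~ (p %| m)%N ->
  \sum_(d <- divisors (m * p ^ k.+1)) mu d * F d =
  \sum_(d <- divisors m) mu d * (F d - F (p * d)%N).
Proof.
move=> pp m0 pm; set n := (m * p ^ k.+1)%N; have p0 := prime_gt0 pp.
have n0 : (0 < n)%N by rewrite muln_gt0 m0 expn_gt0 p0.
have dm d : ~~ (p %| d)%N -> (d %| n)%N = (d %| m)%N.
  by move=> pd; rewrite Gauss_dvdl// coprimeXr// coprime_sym prime_coprime.
have ndm d : (d %| m)%N -> ~~ (p %| d)%N.
  by move=> dvm; apply: contra pm => /dvdn_trans; apply.
have mn : (m <= n)%N by rewrite leq_pmulr// expn_gt0 p0.
have mnp : (m <= n %/ p)%N.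
  by rewrite leq_divRL// leq_mul// expnS leq_pmulr// expn_gt0 p0.
under [RHS]eq_bigr do rewrite mulrBr.
rewrite sumrB sum_divisors// (bigID (fun d => (p %| d)%N))/= addrC; congr (_ + _).
  rewrite (@sum_divisors_widen _ _ n) ?m0//; apply: eq_bigl => d.
  case pd: (p %| d)%N; first by rewrite andbF; apply/esym/negP => /ndm; rewrite pd.
  by rewrite andbT dm// pd.
rewrite big_mkcondl sum_multiples// (@sum_divisors_widen _ _ (n %/ p)) ?m0//.
rewrite -sumrN [RHS]big_mkcond; apply: eq_big_nat => e /andP[e0 _].
case: ifP => [en|/negP en]; case: ifP => em //.
- by rewrite moebius_primeM ?mulNr// ndm.
- case pe: (p %| e)%N; last first.
    by move: em; rewrite -dm ?pe// (dvdn_trans _ en)// dvdn_mull.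
  rewrite (@moebius_sqfactor p) ?mul0r// lognM// logn_prime// eqxx.
  by rewrite add1n ltnS logn_gt0 mem_primes pp e0.
- case: en; rewrite /n mulnC dvdn_mul// expnS dvdn_mulr//.
Qed.

Lemma dirichlet_moebius1 n : (0 < n)%N ->
  dirichlet mu (fun=> 1) n = dirichlet_unit R n.
Proof.
move=> n0; have [->|n1] := eqVneq n 1%N.
  by rewrite /dirichlet /dirichlet_unit/= big_seq1 /mu /moebius/= expr0 mulr1.
rewrite /dirichlet /dirichlet_unit (negbTE n1).
have n2 : (1 < n)%N by case: n n0 n1 => [|[]].
have pp := pdiv_prime n2; have [m pm ->] := pfactor_coprime pp n0.
have : (0 < logn (pdiv n) n)%N by rewrite logn_gt0 mem_primes pp n0 pdiv_dvd.
case: (logn _ _) => [//|k] _.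
rewrite (@sum_moebius_pfactor _ _ _ (fun=> 1)) ?big1// => [d _||].
- by rewrite subrr mulr0.
- apply: contraTT pm; rewrite -eqn0Ngt => /eqP ->.
  by rewrite /coprime gcdn0; case: (pdiv n) pp => [|[|]].
- by rewrite -prime_coprime.
Qed.

Definition arith_ln n : R := ln n%:R.

Definition von_mangoldt := dirichlet mu arith_ln.

Lemma arith_ln_ge0 n : 0 <= arith_ln n.
Proof. by case: n => [|n]; [rewrite /arith_ln ln0|rewrite ln_ge0// ler1n]. Qed.

Lemma arith_lnM m n : (0 < m)%N -> (0 < n)%N ->
  arith_ln (m * n) = arith_ln m + arith_ln n.
Proof. by move=> m0 n0; rewrite /arith_ln natrM lnM// posrE ltr0n. Qed.

(** Since [mu * 1] and [mu * ln] pair [d] with [n / d], [ln (n / d)] is written [F d = ln n - ln d].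
    With [n = m p^(k+1)], the difference [F d - F (p d)] is the constant [ln p], so the value is
    [ln p] times [mu * 1] at [m], which is 0 or 1. *)
Lemma von_mangoldt_ge0 n : (0 < n)%N -> 0 <= von_mangoldt n.
Proof.
move=> n0; have [->|n1] := eqVneq n 1%N.
  by rewrite /von_mangoldt /dirichlet/= big_seq1 /arith_ln divn1 ln1 mulr0.
have n2 : (1 < n)%N by case: n n0 n1 => [|[]].
have pp := pdiv_prime n2; have [m pm nE] := pfactor_coprime pp n0.
have m0 : (0 < m)%N by move: n0; rewrite {1}nE muln_gt0 => /andP[].
have : (0 < logn (pdiv n) n)%N by rewrite logn_gt0 mem_primes pp n0 pdiv_dvd.
move: (pdiv n) pp pm nE => p pp; case: (logn _ _) => [//|k] pm nE _.
have -> : von_mangoldt n = \sum_(d <- divisors n) mu d * (arith_ln n - arith_ln d).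
  rewrite /von_mangoldt /dirichlet !big_seq; apply: eq_bigr => d.
  rewrite -dvdn_divisors// => dn; congr (_ * _).
  rewrite -[in arith_ln n](divnK dn) arith_lnM ?addrK//.
    by rewrite divn_gt0 ?(dvdn_gt0 n0 dn)// dvdn_leq.
  exact: dvdn_gt0 n0 dn.
rewrite {1}nE (@sum_moebius_pfactor _ _ _ (fun d => arith_ln n - arith_ln d))//
  -?prime_coprime//.
rewrite big_seq (eq_bigr (fun d => arith_ln p * (mu d * 1))); last first.
  move=> d; rewrite -dvdn_divisors// => dm.
  by rewrite arith_lnM ?(prime_gt0 pp) ?(dvdn_gt0 m0 dm)//; ring.
rewrite -mulr_sumr -big_seq mulr_ge0 ?arith_ln_ge0//.
by have := dirichlet_moebius1 m0; rewrite /dirichlet => ->; rewrite ler0n.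
Qed.

Lemma dirichlet_von_mangoldt1 n : (0 < n)%N ->
  dirichlet von_mangoldt (fun=> 1) n = arith_ln n.
Proof.
move=> n0; rewrite dirichletC// /von_mangoldt dirichletA//.
rewrite (@eq_dirichlet _ _ (dirichlet_unit R) _ arith_ln) ?dirichlet_unitl// => k k0.
by rewrite dirichletC// dirichlet_moebius1.
Qed.

(** [ln n] is the sum of the nonnegative values of [von_mangoldt] over the divisors of [n], and [n]
    is one of them. *)
Lemma von_mangoldt_le n : (0 < n)%N -> von_mangoldt n <= arith_ln n.
Proof.
move=> n0; rewrite -(dirichlet_von_mangoldt1 n0) /dirichlet sum_divisors//.
rewrite big_mkcond big_nat_recr//= dvdnn mulr1 lerDr big_nat.
apply: sumr_ge0 => d /andP[d0 _]; case: ifP => // _.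
by rewrite mulr1 von_mangoldt_ge0.
Qed.

Lemma arith_id_moebius n : (0 < n)%N ->
  arith_id R n = dirichlet (dirichlet mu (@arith_id R)) (fun=> 1) n.
Proof.
move=> n0; rewrite -dirichletA// dirichletC//.
rewrite -dirichletA// (@eq_dirichlet _ _ (@arith_id R) _ (dirichlet_unit R))
  ?dirichlet_unitr// => k k0.
by rewrite dirichletC// dirichlet_moebius1.
Qed.

Lemma arith_phi_moebius n : (0 < n)%N ->
  arith_phi R n = dirichlet (dirichlet (dirichlet mu mu) (@arith_id R)) (fun=> 1) n.
Proof.
move=> n0; rewrite -dirichletA//.
have phiE k : (0 < k)%N -> dirichlet mu (@arith_id R) k = arith_phi R k.
  move=> k0; rewrite (@eq_dirichlet _ _ mu _ (dirichlet (@arith_phi R) (fun=> 1)))//.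
    rewrite dirichletC// -dirichletA//.
    rewrite (@eq_dirichlet _ _ (@arith_phi R) _ (dirichlet_unit R)) ?dirichlet_unitr// => j j0.
    by rewrite dirichletC// dirichlet_moebius1.
  by move=> j j0; rewrite dirichlet_phi1.
rewrite -dirichletA// -phiE//; apply: eq_dirichlet => // k k0.
by rewrite dirichletA// -arith_id_moebius.
Qed.

End Moebius.

(** * Truncated Dirichlet series at 2 *)

Section Dominated.
Variable R : realType.
Implicit Types (g h : R -> R) (x y : R).

(** Errors are evaluated at [x / n], which goes down to 1, where [ln] vanishes. Bounds by powers of
    [1 + ln x] valid on all of [x >= 1] can be summed over [n <= x] with a single constant. *)
Definition log1 x : R := 1 + ln x.

Definition dominated g h :=
  exists2 C : R, 0 <= C & forall x, 1 <= x -> `|g x| <= C * h x.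

Lemma le_of_eq x y : x = y -> x <= y.
Proof. by move=> ->. Qed.

Lemma log1_ge1 x : 1 <= x -> 1 <= log1 x.
Proof. by move=> x1; rewrite /log1 lerDl ln_ge0. Qed.

Lemma log1_ge0 x : 1 <= x -> 0 <= log1 x.
Proof. by move=> x1; apply: le_trans (log1_ge1 x1). Qed.

Lemma log1_homo x y : 0 < x -> x <= y -> log1 x <= log1 y.
Proof.
by move=> x0 xy; rewrite /log1 lerD2l ler_ln ?posrE// (lt_le_trans x0).
Qed.

Lemma dominated_ext g1 g2 h :
  (forall x, 1 <= x -> g1 x = g2 x) -> dominated g1 h -> dominated g2 h.
Proof. by move=> e [C C0 H]; exists C => // x x1; rewrite -e// H. Qed.

Lemma dominatedD g1 g2 h : dominated g1 h -> dominated g2 h ->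
  dominated (fun x => g1 x + g2 x) h.
Proof.
move=> [C C0 H] [D D0 K]; exists (C + D); first exact: addr_ge0.
by move=> x x1; rewrite (le_trans (ler_normD _ _))// mulrDl lerD ?H ?K.
Qed.

Lemma dominatedM g1 g2 h1 h2 : dominated g1 h1 -> dominated g2 h2 ->
  dominated (fun x => g1 x * g2 x) (fun x => h1 x * h2 x).
Proof.
move=> [C C0 H] [D D0 K]; exists (C * D); first exact: mulr_ge0.
by move=> x x1; rewrite normrM mulrACA ler_pM ?H ?K.
Qed.

Lemma dominatedZ a g h : dominated g h -> dominated (fun x => a * g x) h.
Proof.
move=> [C C0 H]; exists (`|a| * C); first exact: mulr_ge0.
by move=> x x1; rewrite normrM -mulrA ler_wpM2l ?H.
Qed.

Lemma dominatedB g1 g2 h : dominated g1 h -> dominated g2 h ->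
  dominated (fun x => g1 x - g2 x) h.
Proof.
move=> H /(dominatedZ (-1)) K; apply: dominated_ext (dominatedD H K) => x _.
by rewrite mulN1r.
Qed.

Lemma dominated_le g h1 h2 : (forall x, 1 <= x -> h1 x <= h2 x) ->
  dominated g h1 -> dominated g h2.
Proof.
move=> h12 [C C0 H]; exists C => // x x1.
by rewrite (le_trans (H x x1))// ler_wpM2l ?h12.
Qed.

Lemma dominated_ln : dominated (fun x => ln x) (fun x => log1 x ^+ 1).
Proof.
by exists 1 => // x x1; rewrite mul1r expr1 ger0_norm ?ln_ge0// /log1 lerDr.
Qed.

Lemma dominated_cst a : dominated (fun=> a) (fun x => log1 x ^+ 1).
Proof. by exists `|a| => // x x1; rewrite expr1 ler_peMr ?log1_ge1. Qed.

Lemma log1_exprn_le k l x : (k <= l)%N -> 1 <= x -> log1 x ^+ k <= log1 x ^+ l.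
Proof. by move=> kl x1; rewrite ler_weXn2l ?log1_ge1. Qed.

Lemma log1_powers_small k y : 1 <= y -> log1 (y ^+ k.+1) <= k.+1%:R * y.
Proof.
move=> y1; have y0 : 0 < y by apply: lt_le_trans y1.
rewrite /log1 lnXn// -mulr_natl.
have : ln y <= y - 1 by rewrite -{1}(subrKC 1 y) le_ln1Dx//; lra.
have : (1 : R) <= k.+1%:R by rewrite ler1n.
nra.
Qed.

(** At [x = y^(k+1)] the bound is at most a constant times [y^k / y^(k+1)], because [log1 x] grows
    at most linearly in [y]. Hence [|a| y <= K] for all [y >= 1]. *)
Lemma dominated_cst_eq0 a k : dominated (fun=> a) (fun x => log1 x ^+ k / x) -> a = 0.
Proof.
move=> [C C0 H]; apply/eqP/negP => /negP; rewrite -normr_gt0 => a0.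
pose K := C * k.+1%:R ^+ k; have K0 : 0 <= K by rewrite mulr_ge0// exprn_ge0.
(* This [y] exceeds [K / |a|] and is at least 1. *)
pose y := 1 + K / `|a|.
have y1 : 1 <= y by rewrite lerDl divr_ge0.
have y0 : 0 < y by apply: lt_le_trans y1.
have yk1 : 1 <= y ^+ k.+1 by rewrite exprn_ege1.
have := H _ yk1; apply/negP; rewrite -ltNge.
rewrite mulrA ltr_pdivrMr ?exprn_gt0//.
apply: (@le_lt_trans _ _ (K * y ^+ k)).
  rewrite /K -mulrA -exprMn ler_wpM2l// lerXn2r ?nnegrE ?log1_ge0//.
    by rewrite mulr_ge0// ltW.
  exact: log1_powers_small.
rewrite exprS mulrA ltr_pM2r ?exprn_gt0// /y mulrDr mulr1 mulrC divfK ?gt_eqF//.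
by rewrite ltrDr.
Qed.

End Dominated.

(** * Sums over the positive integers up to a real bound *)

Section SummatoryLemmas.
Variable R : realType.
Implicit Types (f g u v F : nat -> R) (x y : R) (n N : nat).

Lemma eq_summatory f g x : (forall n, (0 < n)%N -> n%:R <= x -> f n = g n) ->
  summatory f x = summatory g x.
Proof.
move=> fg; apply: eq_big_nat => n /andP[n0 nx]; apply: fg => //.
have x1 : 1 <= x by rewrite -truncn_gt0 (leq_trans n0).
by rewrite -truncn_ge_nat// (le_trans _ x1).
Qed.

Lemma ler_summatory f g x : (forall n, (0 < n)%N -> n%:R <= x -> f n <= g n) ->
  summatory f x <= summatory g x.
Proof.
move=> fg; apply: ler_sum_nat => n /andP[n0 nx]; apply: fg => //.
have x1 : 1 <= x by rewrite -truncn_gt0 (leq_trans n0).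
by rewrite -truncn_ge_nat// (le_trans _ x1).
Qed.

Lemma ler_norm_summatory f x : `|summatory f x| <= summatory (fun n => `|f n|) x.
Proof. exact: ler_norm_sum. Qed.

Lemma summatoryD f g x :
  summatory (fun n => f n + g n) x = summatory f x + summatory g x.
Proof. exact: big_split. Qed.

Lemma summatoryB f g x :
  summatory (fun n => f n - g n) x = summatory f x - summatory g x.
Proof. by rewrite /summatory sumrB. Qed.

Lemma summatoryZ a f x : summatory (fun n => a * f n) x = a * summatory f x.
Proof. by rewrite /summatory mulr_sumr. Qed.

Lemma summatoryZr a f x : summatory (fun n => f n * a) x = summatory f x * a.
Proof. by rewrite /summatory mulr_suml. Qed.

Lemma truncn_divn x n : 0 <= x -> (0 < n)%N ->
  Num.truncn (x / n%:R) = (Num.truncn x %/ n)%N.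
Proof.
move=> x0 n0; have n0' : 0 < n%:R :> R by rewrite ltr0n.
apply: truncn_def; rewrite ler_pdivlMr// ltr_pdivrMr// -!natrM.
rewrite -truncn_ge_nat// leq_divM/= -truncn_lt_nat//.
by rewrite ltn_ceil.
Qed.

Lemma summatory_dirichlet u v F x : 0 <= x ->
  summatory (fun k => dirichlet u v k * F k) x =
  summatory (fun n => u n * summatory (fun m => v m * F (n * m)%N) (x / n%:R)) x.
Proof.
move=> x0; rewrite /summatory sum_dirichletE; apply: eq_big_nat => n /andP[n0 _].
by rewrite truncn_divn.
Qed.

Lemma ge1_divn x n : (0 < n)%N -> n%:R <= x -> 1 <= x / n%:R <= x.
Proof.
move=> n0 nx; have n0' : 0 < n%:R :> R by rewrite ltr0n.
rewrite ler_pdivlMr// mul1r nx/= ler_pdivrMr// ler_peMr ?ler1n//.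
by rewrite (le_trans _ nx).
Qed.

Lemma truncn_bounds x : 1 <= x -> let N := Num.truncn x in
  [/\ (0 < N)%N, N%:R <= x & x <= 2 * N%:R].
Proof.
move=> x1 N; have N0 : (0 < N)%N by rewrite truncn_gt0.
have /andP[Nx xN] : N%:R <= x < N.+1%:R by apply: truncn_itv; rewrite (le_trans _ x1).
split => //; have : (1 : R) <= N%:R by rewrite ler1n.
by move: xN; rewrite -natr1; lra.
Qed.

Lemma summatory_inv_le x : 1 <= x -> summatory (fun n => n%:R^-1) x <= log1 x.
Proof.
move=> x1; have [N0 Nx _] := truncn_bounds x1.
apply: (@le_trans _ _ (log1 (Num.truncn x)%:R)); last first.
  by apply: log1_homo; rewrite ?ltr0n.
rewrite /summatory; elim: (Num.truncn x) N0 => [//|N IH] _.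
rewrite big_nat_recr//=; have [->|N0] := posnP N.
  by rewrite big_nil add0r invr1 log1_ge1.
have N0' : 0 < N%:R :> R by rewrite ltr0n.
have N1' : 0 < N.+1%:R :> R by rewrite ltr0n.
apply: le_trans (lerD (IH N0) (lexx _)) _; rewrite /log1 -addrA lerD2l.
(* The increment [1 / (N+1)] is at most [- ln (1 - 1 / (N+1)) = ln (N+1) - ln N]. *)
have : ln (N%:R / N.+1%:R) <= - N.+1%:R^-1 :> R.
  have -> : N%:R / N.+1%:R = 1 + - N.+1%:R^-1 :> R.
    by move: N1'; rewrite -natr1 => N1'; field; rewrite gt_eqF.
  apply: le_ln1Dx; rewrite ltrN2 invf_lt1// ltr1n ltnS//.
rewrite ln_div ?posrE//.
by move: (ln _) (ln _) (_^-1) => a b c; lra.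
Qed.

End SummatoryLemmas.

(** * Series at 2 with error rates, and their behaviour under convolution *)

Section Calculus.
Variable R : realType.
Implicit Types (f g : nat -> R) (x y : R) (n N k j : nat).

(* The value at 2 of the Dirichlet series of [f], with a rate of convergence. *)
Definition dseries2 k f (F : R) :=
  dominated (fun x => summatory (fun n => f n / n%:R ^+ 2) x - F)
            (fun x => log1 x ^+ k / x).

(** A tail at [x / n] has size about [n / x]; summed against [f n / n^2] it leaves the weights
    [|f n| / n], whose total is controlled here. *)
Definition harmonic_bound j f :=
  dominated (summatory (fun n => `|f n| / n%:R)) (fun x => log1 x ^+ j).

Lemma dseries2_weaken k l f F : (k <= l)%N -> dseries2 k f F -> dseries2 l f F.
Proof.
move=> kl; apply: dominated_le => x x1; rewrite ler_wpM2r ?log1_exprn_le//.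
by rewrite invr_ge0 (le_trans _ x1).
Qed.

Lemma harmonic_bound_weaken k l f : (k <= l)%N ->
  harmonic_bound k f -> harmonic_bound l f.
Proof. by move=> kl; apply: dominated_le => x x1; rewrite log1_exprn_le. Qed.

(** This turns a convolution identity into an equation between values of series. *)
Lemma dseries2_unique k l f F G : dseries2 k f F -> dseries2 l f G -> F = G.
Proof.
move=> /(dseries2_weaken (leq_maxl k l)) HF /(dseries2_weaken (leq_maxr k l)) HG.
apply/eqP; rewrite -subr_eq0; apply/eqP.
apply: (@dominated_cst_eq0 _ _ (maxn k l)); apply: dominated_ext (dominatedB HG HF).
by move=> x _; ring.
Qed.

Lemma dseries2_ext k f g F : (forall n, (0 < n)%N -> f n = g n) ->
  dseries2 k f F -> dseries2 k g F.
Proof.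
move=> fg; apply: dominated_ext => x _; congr (_ - _).
by apply: eq_summatory => n n0 _; rewrite fg.
Qed.

Lemma harmonic_bound_le k f g : (forall n, (0 < n)%N -> `|g n| <= f n) ->
  harmonic_bound k f -> harmonic_bound k g.
Proof.
move=> fg [C C0 H]; exists C => // x x1; apply: le_trans (H x x1).
have pos h : 0 <= summatory (fun n => `|h n| / n%:R) x.
  by apply: sumr_ge0 => n _; rewrite divr_ge0.
rewrite !ger0_norm//.
apply: ler_summatory => n n0 _; rewrite ler_wpM2r ?invr_ge0//.
by rewrite (le_trans (fg n n0))// ler_norm.
Qed.

Lemma dseries2D k f g F G : dseries2 k f F -> dseries2 k g G ->
  dseries2 k (fun n => f n + g n) (F + G).
Proof.
move=> HF HG; apply: dominated_ext (dominatedD HF HG) => x _.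
rewrite addrACA -opprD -summatoryD; congr (_ - _).
by apply: eq_summatory => n _ _; rewrite mulrDl.
Qed.

Lemma dseries2Z k a f F : dseries2 k f F -> dseries2 k (fun n => a * f n) (a * F).
Proof.
move=> HF; apply: dominated_ext (dominatedZ a HF) => x _.
rewrite mulrBr -summatoryZ; congr (_ - _).
by apply: eq_summatory => n _ _; rewrite mulrA.
Qed.

Lemma harmonic_boundD k f g : harmonic_bound k f -> harmonic_bound k g ->
  harmonic_bound k (fun n => f n + g n).
Proof.
move=> HF HG; apply: (@harmonic_bound_le _ (fun n => `|f n| + `|g n|)).
  by move=> n _; exact: ler_normD.
apply: dominated_ext (dominatedD HF HG) => x _.
rewrite -summatoryD; apply: eq_summatory => n _ _.
by rewrite [in RHS]ger0_norm ?addr_ge0// mulrDl.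
Qed.

Lemma harmonic_boundZ k a f : harmonic_bound k f ->
  harmonic_bound k (fun n => a * f n).
Proof.
move=> HF; apply: dominated_ext (dominatedZ `|a| HF) => x _.
rewrite -summatoryZ.
by apply: eq_summatory => n _ _; rewrite normrM mulrA.
Qed.

(** With absolute values inside, the sum for [f * g] is a sum over [n] of [|f n| / n] times the sum
    for [g] up to [x / n <= x], so the exponents add. *)
Lemma harmonic_bound_dirichlet j k f g : harmonic_bound j f ->
  harmonic_bound k g -> harmonic_bound (j + k) (dirichlet f g).
Proof.
move=> [C C0 H] [D D0 K].
apply: (@harmonic_bound_le _ (dirichlet (fun n => `|f n|) (fun n => `|g n|))).
  by move=> n n0; apply: ler_norm_dirichlet.
exists (C * D); first exact: mulr_ge0.
move=> x x1; have x0 : 0 <= x by apply: le_trans x1.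
rewrite (_ : summatory _ x = summatory (fun n => `|f n| / n%:R *
    summatory (fun m => `|g m| / m%:R) (x / n%:R)) x); last first.
  rewrite -[LHS](@eq_summatory _ (fun k => dirichlet (fun n => `|f n|)
     (fun n => `|g n|) k * k%:R^-1)); last first.
    move=> n n0 _; congr (_ / _); rewrite ger0_norm//.
    by apply: sumr_ge0 => d _; rewrite mulr_ge0.
  rewrite summatory_dirichlet//; apply: eq_summatory => n n0 _.
  rewrite -[RHS]mulrA; congr (_ * _); rewrite -summatoryZ.
  apply: eq_summatory => m m0 _.
  by rewrite natrM invfM; ring.
apply: le_trans (ler_norm_summatory _ _) _.
rewrite exprD mulrACA.
apply: (@le_trans _ _ (summatory (fun n => `|f n| / n%:R * (D * log1 x ^+ k)) x)).
  apply: ler_summatory => n n0 nx; rewrite normrM ger0_norm ?divr_ge0//.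
  have /andP[y1 yx] := ge1_divn n0 nx.
  rewrite ler_wpM2l ?divr_ge0// (le_trans (K _ y1))// ler_wpM2l//.
  rewrite lerXn2r ?nnegrE ?log1_ge0//; apply: log1_homo => //.
  exact: lt_le_trans y1.
rewrite summatoryZr ler_wpM2r ?mulr_ge0 ?exprn_ge0 ?log1_ge0//.
exact: le_trans (ler_norm _) (H x x1).
Qed.

(** The error splits into the tails of [g] at [x / n] weighted by [f n / n^2], and [G] times the
    tail of [f]. The first part is [(ln x)^k / x] times the sum of [|f n| / n], whence [k + j]; the
    second keeps the rate of [f]. *)
Lemma dseries2_dirichlet j k l f g F G : (k + j <= l)%N ->
  dseries2 l f F -> harmonic_bound j f -> dseries2 k g G ->
  dseries2 l (dirichlet f g) (F * G).
Proof.
move=> kjl HF [C C0 H] [D D0 K].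
apply: (@dominated_ext _ (fun x => summatory (fun n => f n / n%:R ^+ 2 *
  (summatory (fun m => g m / m%:R ^+ 2) (x / n%:R) - G)) x +
  G * (summatory (fun n => f n / n%:R ^+ 2) x - F))).
  move=> x x1; have x0 : 0 <= x by apply: le_trans x1.
  rewrite (summatory_dirichlet _ _ (fun k => (k%:R ^+ 2)^-1))//.
  rewrite mulrBr addrA [F * G]mulrC; congr (_ - _).
  rewrite -summatoryZ -summatoryD; apply: eq_summatory => n n0 _.
  rewrite mulrBr [G * _]mulrC subrK -mulrA; congr (_ * _); rewrite -summatoryZ.
  by apply: eq_summatory => m m0 _; rewrite natrM; field;
    rewrite !pnatr_eq0 -!lt0n m0.
apply: dominatedD; last exact: dominatedZ.
apply: (@dominated_le _ _ (fun x => log1 x ^+ (k + j) / x)).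
  move=> x x1; rewrite ler_wpM2r ?log1_exprn_le//.
  by rewrite invr_ge0 (le_trans _ x1).
exists (D * C) => [|x x1]; first exact: mulr_ge0.
have x0 : 0 < x by apply: lt_le_trans x1.
apply: le_trans (ler_norm_summatory _ _) _.
apply: (@le_trans _ _ (summatory (fun n => `|f n| / n%:R * (D * log1 x ^+ k / x)) x)).
  apply: ler_summatory => n n0 nx; have n0' : 0 < n%:R :> R by rewrite ltr0n.
  rewrite !normrM normfV [X in X^-1]ger0_norm ?exprn_ge0//.
  have /andP[y1 yx] := ge1_divn n0 nx.
  apply: (@le_trans _ _ (`|f n| / n%:R ^+ 2 * (D * (log1 x ^+ k / (x / n%:R))))).
    rewrite ler_wpM2l ?divr_ge0 ?exprn_ge0// (le_trans (K _ y1))// ler_wpM2l//.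
    rewrite ler_wpM2r ?invr_ge0 ?divr_ge0 ?(ltW x0)//.
    rewrite lerXn2r ?nnegrE ?log1_ge0//; apply: log1_homo => //.
    exact: lt_le_trans y1.
  apply/le_of_eq; field.
  by rewrite !gt_eqF.
rewrite summatoryZr.
apply: (@le_trans _ _ (C * log1 x ^+ j * (D * log1 x ^+ k / x))).
  rewrite ler_wpM2r ?divr_ge0 ?mulr_ge0 ?exprn_ge0 ?log1_ge0 ?(ltW x0)//.
  exact: le_trans (ler_norm _) (H x x1).
by rewrite exprD; apply/le_of_eq; ring.
Qed.

(** Replacing [floor (x/n)] by [x / n] costs at most [|f n| / n] per term; what is left is [x] times
    a truncated series. *)
Lemma sum_truncn_asymp k f F : dseries2 k f F -> harmonic_bound k f ->
  dominated (fun x => summatory (fun n => f n / n%:R * (Num.truncn (x / n%:R))%:R) x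
                      - F * x) (fun x => log1 x ^+ k).
Proof.
move=> [C C0 H] [D D0 K].
apply: (@dominated_ext _ (fun x => x * (summatory (fun n => f n / n%:R ^+ 2) x - F)
   - summatory (fun n => f n / n%:R * (x / n%:R - (Num.truncn (x / n%:R))%:R)) x)).
  move=> x x1; rewrite mulrBr [F * x]mulrC -summatoryZ addrAC -summatoryB; congr (_ - _).
  apply: eq_summatory => n n0 _; field.
  by rewrite pnatr_eq0 -lt0n.
apply: dominatedB.
  exists C => // x x1; have x0 : 0 < x by apply: lt_le_trans x1.
  rewrite normrM gtr0_norm// mulrC -ler_pdivlMr// -mulrA; exact: H.
exists D => // x x1; apply: le_trans (K x x1).
apply: le_trans (ler_norm_summatory _ _) _.
apply: le_trans (ler_norm _); apply: ler_summatory => n n0 nx.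
rewrite !normrM normfV [`|n%:R|]ger0_norm// ler_piMr ?divr_ge0//.
have /andP[y1 _] := ge1_divn n0 nx.
have /andP[a b] := truncn_itv (le_trans ler01 y1).
by move: b; rewrite -natr1 => b; rewrite ger0_norm; lra.
Qed.

End Calculus.

(** * Stirling and Euler-Maclaurin estimates *)

Section RealLemmas.
Variable R : realType.
Implicit Types (x y : R) (n N : nat).

Lemma is_derive_homo (f df : R -> R) a b :
  (forall x, a <= x <= b -> is_derive x 1 f (df x)) ->
  (forall x, a < x < b -> 0 <= df x) -> a <= b -> f a <= f b.
Proof.
move=> fd df0 ab; apply: (@ger0_derive1_ndecr _ f a b) => //.
- move=> x; rewrite in_itv/= => /andP[ax xb].
  by have fx := fd x; apply: ex_derive; apply: fx; rewrite !ltW.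
- move=> x; rewrite in_itv/= => xab; rewrite derive1E.
  have /andP[ax xb] := xab.
  have fx : is_derive x 1 f (df x) by apply: fd; rewrite !ltW.
  by rewrite derive_val df0.
- apply: continuous_in_subspaceT => x; rewrite inE/= in_itv/= => xab.
  apply: differentiable_continuous; apply/derivable1_diffP.
  by have fx := fd x xab; exact: ex_derive.
Qed.

(** Both sides vanish at 1 and the derivative of their difference is the nonnegative
    [(z - 1)^2 / (z (z + 1)^2)]. The proof uses the form [2 - 4 / (y + 1)] of the left side. *)
Lemma ln_ge_pade y : 1 <= y -> 2 * (y - 1) / (y + 1) <= ln y.
Proof.
move=> y1.
have H : ln (1 : R) + 4 * (1 + 1)^-1 <= ln y + 4 * (y + 1)^-1.
  apply: (@is_derive_homo (fun z => ln z + 4 * (z + 1)^-1)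
    (fun z => z^-1 - 4 * (z + 1) ^- 2)) => //.
    move=> z /andP[z1 _]; have z0 : 0 < z by lra.
    have zn : z + 1 != 0 by rewrite gt_eqF//; lra.
    have := is_derive1_ln z0.
    move=> dl.
    apply: is_derive_eq.
    by rewrite addr0 /GRing.scale/=; field; rewrite zn gt_eqF.
  move=> z /andP[z1 _]; have z0 : 0 < z by lra.
  have zn : 0 < z + 1 by lra.
  have -> : z^-1 - 4 * (z + 1) ^- 2 = (z - 1) ^+ 2 / (z * (z + 1) ^+ 2).
    by field; rewrite !gt_eqF.
  by rewrite divr_ge0 ?sqr_ge0// mulr_ge0 ?sqr_ge0// ltW.
have yn : 0 < y + 1 by lra.
have -> : 2 * (y - 1) / (y + 1) = 2 - 4 / (y + 1) by field; rewrite gt_eqF.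
have e : 4 / (1 + 1) = 2 :> R by field.
by move: H; rewrite ln1 e; move: (4 / (y + 1)) (ln y) => p q h; lra.
Qed.

(** The right side is the trapezoid rule for the integral of [1 / t] over [[1, y]]; the difference
    has derivative [(1 - 1/z)^2 / 2]. *)
Lemma ln_le_mid y : 1 <= y -> ln y <= (y - y^-1) / 2.
Proof.
move=> y1; have : (1 - 1^-1) / 2 - ln (1 : R) <= (y - y^-1) / 2 - ln y.
  apply: (@is_derive_homo (fun z => (z - z^-1) / 2 - ln z)
    (fun z => (1 + z ^- 2) / 2 - z^-1)) => //.
    move=> z /andP[z1 _]; have z0 : 0 < z by lra.
    have zn : z != 0 by rewrite gt_eqF.
    have dl := is_derive1_ln z0.
    have dv : is_derive z 1 (fun y : R => y^-1) _ :=
      @is_deriveV R id z 1 1 zn (is_derive_id _ _).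
    apply: is_derive_eq.
    by rewrite /GRing.scale/=; field.
  move=> z /andP[z1 _]; have z0 : 0 < z by lra.
  have -> : (1 + z ^- 2) / 2 - z^-1 = (1 - z^-1) ^+ 2 / 2.
    by field; rewrite !gt_eqF.
  by rewrite divr_ge0 ?sqr_ge0.
by rewrite invr1 ln1; lra.
Qed.

Lemma ln_succ_ratio n : (0 < n)%N -> ln n.+1%:R = ln n%:R + ln (n.+1%:R / n%:R) :> R.
Proof. by move=> n0; rewrite ln_div ?posrE ?ltr0n// addrC subrK. Qed.

Lemma ln_succ_ge n : (0 < n)%N -> 2 / (2 * n%:R + 1) <= ln (n.+1%:R / n%:R) :> R.
Proof.
move=> n0; have n0' : 0 < n%:R :> R by rewrite ltr0n.
have n1 : 0 < 2 * n%:R + 1 :> R by lra.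
have y1 : 1 <= n.+1%:R / n%:R :> R by rewrite ler_pdivlMr// mul1r ler_nat.
apply: le_trans (ln_ge_pade y1).
apply/le_of_eq; rewrite -[n.+1%:R]natr1; field; rewrite !gt_eqF//; lra.
Qed.

Lemma ln_succ_le n : (0 < n)%N ->
  ln (n.+1%:R / n%:R) <= (2 * n%:R + 1) / (2 * n%:R * (n%:R + 1)) :> R.
Proof.
move=> n0; have n0' : 0 < n%:R :> R by rewrite ltr0n.
have n1 : 0 < n%:R + 1 :> R by lra.
have y1 : 1 <= n.+1%:R / n%:R :> R by rewrite ler_pdivlMr// mul1r ler_nat.
apply: le_trans (ln_le_mid y1) _.
by apply/le_of_eq; rewrite -[n.+1%:R]natr1; field; rewrite !gt_eqF.
Qed.

Lemma eq0_of_le_inv (a K : R) : (forall n, (0 < n)%N -> `|a| <= K / n%:R) -> a = 0.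
Proof.
move=> H; apply/eqP/negP => /negP; rewrite -normr_gt0 => a0.
have K0 : 0 <= K by have := H 1%N isT; rewrite divr1; apply: le_trans.
pose n := (Num.truncn (K / `|a|)).+1; have := H n isT; apply/negP; rewrite -ltNge.
by rewrite ltr_pdivrMr ?ltr0n// mulrC -ltr_pdivrMr// truncnS_gt.
Qed.

(** [a - b] increases, [a + b] decreases and [b] tends to 0, so both squeeze the same limit.
    Existence and rate come together, for Stirling's sequence, Euler's constant and the Dirichlet
    series alike. *)
Lemma cvg_telescope (a b : nat -> R) :
  (forall n, (0 < n)%N -> `|a n.+1 - a n| <= b n - b n.+1) -> b @ \oo --> 0 ->
  exists2 l : R, a @ \oo --> l & forall n, (0 < n)%N -> `|a n - l| <= b n.
Proof.
move=> ab b0.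
(* The increments are controlled only from index 1 on, hence the shift. *)
pose a' n := a n.+1; pose b' n := b n.+1.
have b'0 : b' @ \oo --> 0 by rewrite /b' (cvg_shiftS b).
have ab' n : `|a' n.+1 - a' n| <= b' n - b' n.+1 by exact: ab.
have b'ge0 n : 0 <= b' n.
  rewrite -(cvg_lim _ b'0)//; apply: nonincreasing_cvgn_ge => //.
    by apply/nonincreasing_seqP => m; rewrite -subr_ge0 (le_trans _ (ab' m)).
  by apply/cvg_ex; exists 0.
pose c n := a' n - b' n; pose e n := a' n + b' n.
have cnd : nondecreasing_seq c.
  apply/nondecreasing_seqP => m; have := ab' m; rewrite ler_norml /c; lra.
have eni : nonincreasing_seq e.
  apply/nonincreasing_seqP => m; have := ab' m; rewrite ler_norml /e; lra.
have cub n : c n <= e 0%N.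
  apply: (@le_trans _ _ (e n)); first by rewrite /c /e; have := b'ge0 n; lra.
  exact: eni.
have ccvg : cvgn c.
  apply: nondecreasing_is_cvgn => //; exists (e 0%N) => _ [n _ <-]; exact: cub.
have a'E : a' = c \+ b' by apply/funext => n; rewrite /c /= subrK.
have a'l : a' @ \oo --> limn c.
  by rewrite a'E -[limn c]addr0; apply: cvgD.
have el : e @ \oo --> limn c.
  by rewrite -[limn c]addr0; apply: cvgD.
exists (limn c); first by rewrite -(cvg_shiftS a).
case=> [//|n] _; have h1 := nondecreasing_cvgn_le cnd ccvg n.
have h2 : limn c <= e n.
  rewrite -(cvg_lim _ el)//; apply: nonincreasing_cvgn_ge => //.
  by apply/cvg_ex; exists (limn c).
rewrite -/(a' n) -/(b' n) ler_norml; move: h1 h2; rewrite /c /e; lra.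
Qed.

Lemma cvg_inv_nat K : (fun n => K / n%:R : R) @ \oo --> 0.
Proof.
have : K * harmonic n @[n --> \oo] --> K * 0 by apply: cvgMl_tmp; exact: cvg_harmonic.
by rewrite mulr0 -(cvg_shiftS (fun n => K / n%:R)).
Qed.

Definition ln_fact n : R := \sum_(1 <= k < n.+1) ln k%:R.

Lemma ln_factS n : ln_fact n.+1 = ln_fact n + ln n.+1%:R.
Proof. by rewrite /ln_fact big_nat_recr. Qed.

(** The logarithm of [n! e^n / n^(n + 1/2)]. *)
Definition stirling_seq n : R := ln_fact n - (n%:R + 2^-1) * ln n%:R + n%:R.

(** The difference is [(n + 1/2) ln ((n+1)/n) - 1]. The Pade bound makes it nonnegative and the
    trapezoid bound makes it at most [1 / (4 n (n+1))], which telescopes; this is the source of the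
    constant 1/4. *)
Lemma stirling_seq_step n : (0 < n)%N ->
  0 <= stirling_seq n - stirling_seq n.+1 <= 4^-1 / n%:R - 4^-1 / n.+1%:R.
Proof.
move=> n0; have n0' : 0 < n%:R :> R by rewrite ltr0n.
have -> : stirling_seq n - stirling_seq n.+1 =
    (n%:R + 2^-1) * ln (n.+1%:R / n%:R) - 1.
  by rewrite /stirling_seq ln_factS ln_succ_ratio// -natr1; field.
have n1 : 0 < n%:R + 1 :> R by lra.
have n2 : 0 < 2 * n%:R + 1 :> R by lra.
have nh : 0 < n%:R + 2^-1 :> R by lra.
apply/andP; split.
  have /(ler_wpM2l (ltW nh)) := ln_succ_ge n0.
  have -> : (n%:R + 2^-1) * (2 / (2 * n%:R + 1)) = 1 :> R.
    by field; rewrite gt_eqF.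
  by rewrite subr_ge0.
have /(ler_wpM2l (ltW nh)) := ln_succ_le n0; rewrite -(lerD2r (-1)).
move/le_trans; apply; apply/le_of_eq; rewrite -[n.+1%:R]natr1; field.
by rewrite !gt_eqF.
Qed.

Lemma stirling_seq_cvg : exists2 c : R, stirling_seq @ \oo --> c &
  forall n, (0 < n)%N -> 0 <= stirling_seq n - c <= 4^-1 / n%:R.
Proof.
have [c cc Hc] : exists2 c : R, stirling_seq @ \oo --> c &
    forall n, (0 < n)%N -> `|stirling_seq n - c| <= 4^-1 / n%:R.
  apply: cvg_telescope => [n n0|]; last exact: cvg_inv_nat.
  have /andP[h1 h2] := stirling_seq_step n0.
  by rewrite distrC ger0_norm.
exists c => // n n0; rewrite (le_trans (ler_norm _) (Hc n n0)) andbT subr_ge0.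
case: n n0 => [//|n] _.
have -> : c = limn (fun n => stirling_seq n.+1).
  by apply/esym/cvg_lim => //; rewrite (cvg_shiftS stirling_seq).
apply: (@nonincreasing_cvgn_ge _ (fun n => stirling_seq n.+1)).
  apply/nonincreasing_seqP => m.
  by have /andP[+ _] := @stirling_seq_step m.+1 isT; rewrite subr_ge0.
by apply/cvg_ex; exists c; rewrite (cvg_shiftS stirling_seq).
Qed.

(** In the hyperbola method this sum is multiplied by [y], of order [n^2]: an error [1 / n^2] costs
    a constant, so the term [1 / (2n)] must be made explicit. The increments lie between 0 and the
    gap [1 / (2n (n+1) (2n+1))] of the two bounds for [ln ((n+1)/n)]. *)
Lemma harmonic_sum_asymp n : (0 < n)%N ->
  `|\sum_(1 <= k < n.+1) k%:R^-1 - ln n%:R - 2^-1 / n%:R - @euler_gamma R|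
    <= 8^-1 / n%:R ^+ 2.
Proof.
pose h n : R := \sum_(1 <= k < n.+1) k%:R^-1 - ln n%:R - 2^-1 / n%:R.
have [l hl H] : exists2 l : R, h @ \oo --> l &
    forall n, (0 < n)%N -> `|h n - l| <= 8^-1 / n%:R ^+ 2.
  apply: cvg_telescope => [m m0|]; last first.
    rewrite -[X in _ --> X](mulr0 8^-1); apply: cvgMr.
    have -> : (fun m => (m%:R ^+ 2)^-1) = (fun m : nat => 1 / m%:R * (1 / m%:R) : R).
      by apply/funext => m; rewrite mul1r expr2 invfM.
    by rewrite -[X in _ --> X](mulr0 0); apply: cvgM; exact: cvg_inv_nat.
  have m0' : 0 < m%:R :> R by rewrite ltr0n.
  have m1 : 0 < m%:R + 1 :> R by lra.
  have m2 : 0 < 2 * m%:R + 1 :> R by lra.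
  have -> : h m.+1 - h m =
      (2 * m%:R + 1) / (2 * m%:R * (m%:R + 1)) - ln (m.+1%:R / m%:R).
    rewrite /h big_nat_recr//= ln_succ_ratio//.
    by rewrite -!natr1; field; rewrite !gt_eqF.
  rewrite ger0_norm ?subr_ge0 ?ln_succ_le//.
  apply: (@le_trans _ _ ((2 * m%:R + 1) / (2 * m%:R * (m%:R + 1)) - 2 / (2 * m%:R + 1))).
    by rewrite lerB// ln_succ_ge.
  rewrite -[m.+1%:R]natr1 -subr_ge0.
  have -> : 8^-1 / m%:R ^+ 2 - 8^-1 / (m%:R + 1) ^+ 2 -
      ((2 * m%:R + 1) / (2 * m%:R * (m%:R + 1)) - 2 / (2 * m%:R + 1)) =
      1 / (8 * m%:R ^+ 2 * (m%:R + 1) ^+ 2 * (2 * m%:R + 1)) :> R.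
    by field; rewrite !gt_eqF.
  by rewrite divr_ge0// !mulr_ge0// ?exprn_ge0// ltW.
suff -> : euler_gamma = l by exact: H.
apply/cvg_lim => //.
have -> : (fun n => \sum_(1 <= k < n.+1) k%:R^-1 - ln n%:R) =
          (fun n => h n + 2^-1 / n%:R) :> (nat -> R).
  by apply/funext => m; rewrite /h subrK.
by rewrite -[X in _ --> X]addr0; apply: cvgD => //; exact: cvg_inv_nat.
Qed.
End RealLemmas.

(** * Wallis product and Stirling constant *)

Section Wallis.
Variable R : realType.
Implicit Types (x : R) (n m : nat).

(* The antiderivative of [cos ^+ n] vanishing at 0. *)
Fixpoint cosX_primitive n x : R :=
  match n with
  | 0 => x
  | 1 => sin x
  | m.+2 => (sin x * cos x ^+ m.+1 + m.+1%:R * cosX_primitive m x) / m.+2%:R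
  end.

Lemma is_derive_cosX_primitive n x :
  is_derive x 1 (cosX_primitive n) (cos x ^+ n).
Proof.
(* The reduction formula lowers the exponent by two, so the induction carries two consecutive
   indices. *)
suff [] : is_derive x 1 (cosX_primitive n) (cos x ^+ n) /\
  is_derive x 1 (cosX_primitive n.+1) (cos x ^+ n.+1) by [].
elim: n => [|n [IH1 IH2]].
  split; first by rewrite expr0; exact: is_derive_id.
  by rewrite expr1; exact: is_derive_sin.
split=> //.
rewrite (_ : cosX_primitive n.+2 = fun x => n.+2%:R^-1 *
   (sin x * cos x ^+ n.+1 + n.+1%:R * cosX_primitive n x)); last first.
  by apply/funext => y /=; rewrite mulrC.
have dX : is_derive x 1 (fun y => cos y ^+ n.+1) ((n.+1%:R * cos x ^+ n) *: - sin x).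
  rewrite (_ : (fun y => cos y ^+ n.+1) = (@cos R) ^+ n.+1).
    exact: is_deriveX.
  by apply/funext => y; rewrite fctE.
apply: is_derive_eq.
rewrite /GRing.scale/=.
have s2 : sin x ^+ 2 = 1 - cos x ^+ 2 by rewrite -(cos2Dsin2 x) addrC addKr.
have n2 : n%:R + 1 + 1 != 0 :> R by rewrite gt_eqF// !ltr_wpDl.
transitivity ((n%:R + 1 + 1)^-1 * (cos x ^+ n.+2 + (n%:R + 1) * cos x ^+ n *
   (1 - sin x ^+ 2)) : R).
  by rewrite -!natr1 !exprS; ring.
by rewrite s2 !exprS; field.
Qed.

(** The integral of [cos ^+ n] over [[0, pi/2]], expressed by the primitive. *)
Definition wallis_int n : R := cosX_primitive n (pi / 2).

Lemma wallis_intSS n : wallis_int n.+2 = n.+1%:R / n.+2%:R * wallis_int n.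
Proof. by rewrite /wallis_int/= cos_pihalf expr0n/= mulr0 add0r mulrAC. Qed.

Lemma cosX_primitive0 n : cosX_primitive n 0 = 0.
Proof.
suff [] : cosX_primitive n 0 = 0 /\ cosX_primitive n.+1 0 = 0 by [].
elim: n => [|n [IH1 IH2]]; first by rewrite /= sin0.
by split => //=; rewrite sin0 IH1 mul0r mulr0 addr0 mul0r.
Qed.

Lemma wallis_int_gt0 n : 0 < wallis_int n.
Proof.
suff /andP[] : (0 < wallis_int n) && (0 < wallis_int n.+1) by [].
elim: n => [|n /andP[IH1 IH2]].
  by rewrite /wallis_int/= sin_pihalf ltr01 andbT divr_gt0// pi_gt0.
by rewrite IH2/= wallis_intSS mulr_gt0// divr_gt0// ltr0n.
Qed.

Lemma wallis_int_decr n : wallis_int n.+1 <= wallis_int n.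
Proof.
rewrite -subr_ge0.
have := @is_derive_homo R (fun x => cosX_primitive n x - cosX_primitive n.+1 x)
  (fun x => cos x ^+ n - cos x ^+ n.+1) 0 (pi / 2).
rewrite !cosX_primitive0 subrr; apply.
- move=> x _; have d1 := is_derive_cosX_primitive n x.
  by have d2 := is_derive_cosX_primitive n.+1 x; apply: is_deriveB.
- move=> x /andP[x0 xp]; rewrite exprS -{1}[cos x ^+ n]mul1r -mulrBl.
  rewrite mulr_ge0 ?subr_ge0 ?cos_le1// exprn_ge0// ltW// cos_gt0_pihalf//.
  by rewrite xp (lt_trans _ x0)// oppr_lt0 divr_gt0// pi_gt0.
- by rewrite divr_ge0// pi_ge0.
Qed.

(** By the reduction formula the product does not depend on [n]; its value at 0 is how [pi] enters
    Stirling's constant. *)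
Lemma wallis_int_prod n : n.+1%:R * wallis_int n * wallis_int n.+1 = pi / 2.
Proof.
elim: n => [|n IH]; first by rewrite /wallis_int/= sin_pihalf mulr1 mul1r.
rewrite -IH wallis_intSS; field.
by rewrite gt_eqF// ltr_wpDr.
Qed.

(** In multiplicative form, the integral is [pi / 2] times [(2n)! / (4^n n!^2)]. *)
Lemma ln_wallis_int_even n :
  ln (wallis_int n.*2) = ln (pi / 2) + ln_fact R n.*2 - 2 * n%:R * ln 2 - 2 * ln_fact R n.
Proof.
elim: n => [|n IH].
  by rewrite /wallis_int/= /ln_fact !big_nil !(mulr0, mul0r, addr0, subr0).
rewrite doubleS wallis_intSS [in LHS]lnM ?posrE ?wallis_int_gt0 ?divr_gt0 ?ltr0n//.
rewrite IH !ln_factS [ln (_.+1%:R / _)]ln_div ?posrE ?ltr0n//.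
rewrite (_ : n.*2.+2%:R = 2 * n.+1%:R :> R); last first.
  by rewrite -doubleS -muln2 mulnC natrM.
rewrite [in ln (2 * _)]lnM ?posrE ?ltr0n// -[n.+1%:R]natr1.
by move: (ln _) (ln _) (ln _) (ln _) => *; ring.
Qed.

(** With [m = 2n], monotonicity and the product formula at [m - 1] and [m] give
    [m W(m)^2 <= pi / 2 <= (m + 1) W(m)^2], and [ln (m+1) - ln m <= 1 / m]. *)
Lemma ln_wallis_int_bound n : (0 < n)%N ->
  `|2 * ln (wallis_int n.*2) + ln n.*2%:R - ln (pi / 2)| <= n%:R^-1.
Proof.
case: n => [//|n] _; set m := n.+1.*2.
have m0 : (0 < m)%N by [].
have m0' : 0 < m%:R :> R by rewrite ltr0n.
have W0 := wallis_int_gt0 m.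
have pi2 : 0 < pi / 2 :> R by rewrite divr_gt0 ?pi_gt0.
have up : 2 * ln (wallis_int m) + ln m%:R <= ln (pi / 2).
  have -> : 2 * ln (wallis_int m) + ln m%:R = ln (m%:R * (wallis_int m * wallis_int m)).
    move: (m%:R) m0' (wallis_int m) W0 => a a0 w w0.
    by rewrite lnM ?posrE ?mulr_gt0// [in ln (w * w)]lnM ?posrE//; ring.
  have h : 0 < m%:R * (wallis_int m * wallis_int m) by rewrite mulr_gt0// mulr_gt0.
  rewrite ler_ln ?posrE//.
  rewrite -(wallis_int_prod n.*2.+1) -doubleS -/m mulrA ler_pM2r// ler_pM2l//.
  by rewrite /m doubleS wallis_int_decr.
have lo : ln (pi / 2) <= 2 * ln (wallis_int m) + ln m.+1%:R.
  have -> : 2 * ln (wallis_int m) + ln m.+1%:R = ln (m.+1%:R * (wallis_int m * wallis_int m)).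
    have : 0 < m.+1%:R :> R by rewrite ltr0n.
    move: (m.+1%:R) (wallis_int m) W0 => a w w0 a0.
    by rewrite lnM ?posrE ?mulr_gt0// [in ln (w * w)]lnM ?posrE//; ring.
  have h : 0 < m.+1%:R * (wallis_int m * wallis_int m).
    by rewrite mulr_gt0 ?ltr0n// mulr_gt0.
  rewrite ler_ln ?posrE//.
  have p : 0 < m.+1%:R * wallis_int m by rewrite mulr_gt0// ltr0n.
  by rewrite -(wallis_int_prod m) mulrA ler_pM2l// wallis_int_decr.
have lnS : ln m.+1%:R <= ln m%:R + m%:R^-1 :> R.
  rewrite ln_succ_ratio// lerD2l -natr1 mulrDl divff ?gt_eqF// mul1r le_ln1Dx//.
  by rewrite (lt_trans (_ : -1 < 0))// ?invr_gt0//; lra.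
have mn : m%:R^-1 <= n.+1%:R^-1 :> R.
  by rewrite lef_pV2 ?posrE ?ltr0n// ler_nat /m -addnn leq_addr.
rewrite ler_norml; move: up lo lnS mn.
move: (ln m.+1%:R) (ln m%:R) (ln (pi / 2)) (ln (wallis_int m)) (m%:R^-1) (n.+1%:R^-1).
by move=> a b c d e f h1 h2 h3 h4; lra.
Qed.

(** Stirling's expressions for [n!] and [(2n)!] put into Wallis' estimate cancel every [ln n],
    leaving [2 c = ln (pi/2) + 2 ln 2] up to an error [O(1/n)]. *)
Lemma stirling_constant c :
  (forall n, (0 < n)%N -> 0 <= stirling_seq R n - c <= 4^-1 / n%:R) ->
  c = ln (Num.sqrt (2 * pi)).
Proof.
move=> H; have pi0 := @pi_gt0 R.
have p2 : 0 < 2 * pi :> R by rewrite mulr_gt0.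
have -> : ln (Num.sqrt (2 * pi)) = (ln (pi / 2) + 2 * ln 2) / 2 :> R.
  have -> : ln (pi / 2) + 2 * ln 2 = ln (2 * pi) :> R.
    rewrite ln_div ?posrE// lnM ?posrE//; ring.
  by rewrite -{2}(@sqr_sqrtr _ (2 * pi)) ?(ltW p2)// lnXn ?sqrtr_gt0// -mulr_natl; field.
suff : 2 * c - (ln (pi / 2) + 2 * ln 2) = 0 by lra.
(* The errors are [1/n] from Wallis, [2 / (8n)] from [(2n)!] and [4 / (4n)] from [n!], in total
   below [3/n]. *)
apply: (@eq0_of_le_inv _ _ 3) => n n0; have n0' : 0 < n%:R :> R by rewrite ltr0n.
have := ln_wallis_int_bound n0; rewrite ln_wallis_int_even.
have := H _ n0; have := H n.*2; rewrite double_gt0 => /(_ n0).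
have -> : ln_fact R n.*2 = stirling_seq R n.*2 + (n.*2%:R + 2^-1) * ln n.*2%:R - n.*2%:R.
  by rewrite /stirling_seq; ring.
have -> : ln_fact R n = stirling_seq R n + (n%:R + 2^-1) * ln n%:R - n%:R.
  by rewrite /stirling_seq; ring.
have -> : n.*2%:R = 2 * n%:R :> R by rewrite -muln2 mulnC natrM.
rewrite [in ln (2 * n%:R)]lnM ?posrE//.
set s1 := stirling_seq R n.*2; set s2 := stirling_seq R n.
move: (ln (pi / 2)) (ln 2) (ln n%:R) => a b d.
rewrite (_ : 2 * (_ + _ - _ - _) + _ - _ = a + 2 * b + 2 * s1 - 4 * s2); last first.
  by field.
have -> : 4^-1 / (2 * n%:R) = 8^-1 * n%:R^-1 :> R by field; rewrite gt_eqF.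
move: (n%:R^-1) => u; rewrite !ler_norml; lra.
Qed.

End Wallis.

(** * The zeta function near 2 *)

Section Zeta.
Variable R : realType.
Implicit Types (f : nat -> R) (x h : R) (n N : nat).

Lemma cvg_inv_sqrt (K : R) : (fun n => K / Num.sqrt n%:R : R) @ \oo --> 0.
Proof.
have s0 : Num.sqrt (n%:R^-1 : R) @[n --> \oo] --> Num.sqrt (0 : R).
  apply: continuous_cvg; first exact: sqrt_continuous.
  by have := @cvg_inv_nat R 1; under eq_fun do rewrite mul1r.
have : K * Num.sqrt (n%:R^-1 : R) @[n --> \oo] --> K * Num.sqrt (0 : R).
  exact: cvgMl_tmp.
rewrite sqrtr0 mulr0; under eq_fun do rewrite sqrtrV ?ler0n//.
by [].
Qed.

(** The telescoping majorant [b] bounds the tail beyond [N = floor x]; passing from [N] to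
    [x <= 2 N] doubles the constant. *)
Lemma dseries2_telescope k f (b : nat -> R) (K : R) : 0 <= K ->
  (forall n, (0 < n)%N -> `|f n.+1| / n.+1%:R ^+ 2 <= b n - b n.+1) ->
  b @ \oo --> 0 -> (forall n, (0 < n)%N -> b n <= K * (log1 n%:R ^+ k / n%:R)) ->
  exists2 F : R, \sum_(1 <= n < N.+1) f n / n%:R ^+ 2 @[N --> \oo] --> F &
    dseries2 k f F.
Proof.
move=> K0 fb b0 bK.
have step n : (0 < n)%N -> `|\sum_(1 <= m < n.+2) f m / m%:R ^+ 2 -
    \sum_(1 <= m < n.+1) f m / m%:R ^+ 2| <= b n - b n.+1.
  move=> n0; rewrite big_nat_recr//= addrAC subrr add0r normrM normfV.
  by rewrite [`|_ ^+ 2|]ger0_norm ?exprn_ge0// fb.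
have [F FF HF] := cvg_telescope step b0.
exists F => //; exists (2 * K) => [|x x1]; first by rewrite mulr_ge0.
have [N0 Nx xN] := truncn_bounds x1; rewrite /summatory.
move: (Num.truncn x) N0 Nx xN => N N0 Nx xN.
have N0' : 0 < N%:R :> R by rewrite ltr0n.
have x0 : 0 < x by lra.
have N1 : 1 <= N%:R :> R by rewrite ler1n.
apply: le_trans (HF N N0) _; apply: le_trans (bK N N0) _.
have -> : 2 * K * (log1 x ^+ k / x) = K * (log1 x ^+ k * (2 / x)) by ring.
rewrite ler_wpM2l// ler_pM ?exprn_ge0 ?log1_ge0 ?invr_ge0 ?ler0n//.
  by rewrite lerXn2r ?nnegrE ?log1_ge0// log1_homo.
by rewrite ler_pdivlMr// ler_pdivrMl// mulrC.
Qed.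

Lemma dseries2_bounded f A : (forall n, (0 < n)%N -> `|f n| <= A) ->
  exists2 F : R, \sum_(1 <= n < N.+1) f n / n%:R ^+ 2 @[N --> \oo] --> F &
    dseries2 0 f F.
Proof.
move=> fA; have A0 : 0 <= A by apply: le_trans (fA 1%N isT).
apply: (@dseries2_telescope 0 f (fun n => A / n%:R) A) => //.
- move=> n n0; have n0' : 0 < n%:R :> R by rewrite ltr0n.
  have n1 : 0 < n%:R + 1 :> R by lra.
  apply: (@le_trans _ _ (A / n.+1%:R ^+ 2)).
    by rewrite ler_wpM2r ?fA// invr_ge0 exprn_ge0.
  rewrite -mulrBr ler_wpM2l// -[n.+1%:R]natr1 -subr_ge0.
  have -> : n%:R^-1 - (n%:R + 1)^-1 - (n%:R + 1) ^- 2 = 1 / (n%:R * (n%:R + 1) ^+ 2) :> R.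
    by field; rewrite !gt_eqF.
  by rewrite divr_ge0// mulr_ge0// exprn_ge0// ltW.
- exact: cvg_inv_nat.
- by move=> n n0; rewrite expr0 mul1r.
Qed.

Lemma ln_nat_le_sqrt n : (0 < n)%N -> ln n%:R <= 2 * Num.sqrt n%:R :> R.
Proof.
move=> n0; have n0' : 0 < n%:R :> R by rewrite ltr0n.
have s0 : 0 < Num.sqrt n%:R :> R by rewrite sqrtr_gt0.
rewrite -[in ln _](sqr_sqrtr (ltW n0')) lnXn// mulr2n.
by have := ln_sublinear s0; lra.
Qed.

Lemma dseries2_ln_bounded f : (forall n, (0 < n)%N -> `|f n| <= ln n%:R) ->
  exists2 F : R, \sum_(1 <= n < N.+1) f n / n%:R ^+ 2 @[N --> \oo] --> F &
    dseries2 1 f F.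
Proof.
move=> fA.
have ln0 n : 0 <= ln n%:R :> R by exact: arith_ln_ge0.
(* [(1 + ln n) / n] is the integral of [ln t / t^2] from [n] to infinity; the additional [1/n] pays
   for the discretization. *)
apply: (@dseries2_telescope 1 f (fun n => (2 + ln n%:R) / n%:R) 2) => //.
- move=> n n0; have n0' : 0 < n%:R :> R by rewrite ltr0n.
  have n1 : 0 < n%:R + 1 :> R by lra.
  apply: (@le_trans _ _ (ln n.+1%:R / n.+1%:R ^+ 2)).
    by rewrite ler_wpM2r ?fA// invr_ge0 exprn_ge0.
  have l1 : ln (n.+1%:R / n%:R) <= n%:R^-1 :> R.
    rewrite -natr1 mulrDl divff ?gt_eqF// mul1r le_ln1Dx//.
    by rewrite (lt_trans (_ : -1 < 0))// ?invr_gt0//; lra.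
  have l0 : 0 <= ln (n.+1%:R / n%:R) :> R.
    by rewrite ln_ge0// ler_pdivlMr// mul1r ler_nat.
  have lnn := ln0 n.
  rewrite ln_succ_ratio//; move: l1 l0 lnn; rewrite -[n.+1%:R]natr1.
  move: (ln ((n%:R + 1) / n%:R)) (ln n%:R) => d l.
  move=> l1 l0 lnn; rewrite -subr_ge0.
  have {}l1 : d * n%:R <= 1 by rewrite -ler_pdivlMr// mul1r.
  have -> : (2 + l) / n%:R - (2 + (l + d)) / (n%:R + 1) - (l + d) / (n%:R + 1) ^+ 2 =
     ((2 + l) * (n%:R + 1) - d * n%:R * (n%:R + 1) - (l + d) * n%:R) / (n%:R * (n%:R + 1) ^+ 2).
    by field; rewrite !gt_eqF.
  rewrite divr_ge0//.
  nra.
(* From [ln n <= 2 sqrt n] and [sqrt n >= 1], the majorant is at most [4 / sqrt n]. *)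
- apply: (@squeeze_cvgr _ _ _ _ (fun=> 0) (fun n => 4 / Num.sqrt n%:R)); last 2 first.
  + exact: cvg_cst.
  + exact: cvg_inv_sqrt.
  near=> n; have n0 : (0 < n)%N by near: n; exists 1%N.
  have n0' : 0 < n%:R :> R by rewrite ltr0n.
  have n1 : 1 <= n%:R :> R by rewrite ler1n.
  have s0 : 0 < Num.sqrt n%:R :> R by rewrite sqrtr_gt0.
  have s1 : 1 <= Num.sqrt n%:R :> R by rewrite -[leLHS]sqrtr1 ler_wsqrtr.
  have e : 4 / Num.sqrt n%:R * n%:R = 4 * Num.sqrt n%:R :> R.
    have := sqr_sqrtr (ltW n0'); move: (Num.sqrt _) s0 => s s0 sn.
    by rewrite -sn; field; rewrite gt_eqF.
  rewrite divr_ge0 ?addr_ge0//= ler_pdivrMr// e.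
  by have := ln_nat_le_sqrt n0; move: (Num.sqrt _) s1 => s s1; lra.
- move=> n n0; rewrite expr1 mulrA ler_wpM2r ?invr_ge0// /log1.
  by have := ln0 n; lra.
Unshelve. all: end_near. Qed.

Lemma harmonic_bound1 : harmonic_bound 1 (fun=> 1 : R).
Proof.
exists 1 => // x x1; rewrite mul1r expr1 ger0_norm; last first.
  by apply: sumr_ge0 => n _; rewrite divr_ge0.
apply: le_trans (summatory_inv_le x1); apply: ler_summatory => n _ _.
by rewrite normr1 mul1r.
Qed.

Lemma harmonic_bound_arith_ln : harmonic_bound 2 (@arith_ln R).
Proof.
exists 1 => // x x1; have x0 : 0 < x by apply: lt_le_trans x1.
rewrite mul1r ger0_norm; last first.
  by apply: sumr_ge0 => n _; rewrite divr_ge0.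
apply: (@le_trans _ _ (summatory (fun n => log1 x * n%:R^-1) x)).
  apply: ler_summatory => n n0 nx; rewrite ler_wpM2r ?invr_ge0//.
  rewrite ger0_norm ?arith_ln_ge0// (@le_trans _ _ (ln x))//; last by rewrite /log1 lerDr.
  by rewrite ler_ln ?posrE// ltr0n.
by rewrite summatoryZ expr2 ler_wpM2l ?log1_ge0// summatory_inv_le.
Qed.

Lemma zeta_cvg s (F : R) :
  \sum_(1 <= n < N.+1) (n%:R `^ s)^-1 @[N --> \oo] --> F -> zeta s = F.
Proof.
move=> H; apply/cvg_lim => //.
rewrite (_ : series _ = fun N => \sum_(1 <= n < N.+1) (n%:R `^ s)^-1)//.
by apply/funext => N; rewrite /series/= big_add1.
Qed.

Lemma powR2 n : n%:R `^ 2 = n%:R ^+ 2 :> R.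
Proof. by rewrite powR_mulrn. Qed.

Lemma dseries2_zeta : dseries2 0 (fun=> 1) (zeta (2 : R)).
Proof.
have [F FF H] := @dseries2_bounded (fun=> 1) 1 (fun _ _ => le_of_eq (normr1 R)).
rewrite (@zeta_cvg 2 F)//.
by under eq_fun do under eq_bigr do rewrite powR2 -[_^-1]mul1r.
Qed.

(** From [expR v - 1 <= v * expR v], the remainder is at most [v (expR v - 1)]; this is bounded by
    [v^2 expR v] for [v >= 0] and by [v^2] for [v < 0]. *)
Lemma expR_taylor1 (v : R) : `|expR v - 1 - v| <= v ^+ 2 * expR `|v|.
Proof.
have h1 := expR_ge1Dx v.
have h2 : expR v - 1 <= v * expR v.
  have := expR_ge1Dx (- v); have e := expRxMexpNx_1 v; have p := expR_gt0 v.
  by move: e p; rewrite mulrC; move: (expR v) (expR (- v)) => a b; nra.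
rewrite ger0_norm; last by lra.
have [v0|v0] := leP 0 v; first by rewrite ger0_norm//; nra.
have h3 : 1 <= expR `|v| by rewrite -expR0 ler_expR.
have : v ^+ 2 <= v ^+ 2 * expR `|v| by rewrite ler_peMr ?sqr_ge0.
by apply: le_trans; nra.
Qed.

(** The second-order remainder in [h] of [n^-(2+h)]. For [|h| <= 1/4] the exponential costs
    [n^(1/4)], and [(ln n)^2 <= 64 n^(1/4)] costs as much again, so the bound is a summable
    [n^(-3/2)]. *)
Lemma zeta_remainder_bound h n : `|h| <= 4^-1 -> (0 < n)%N ->
  `|(n%:R `^ (2 + h))^-1 - n%:R ^- 2 + h * (ln n%:R / n%:R ^+ 2)| <=
  64 * h ^+ 2 / (n%:R * Num.sqrt n%:R).
Proof.
move=> h4 n0; have n0' : 0 < n%:R :> R by rewrite ltr0n.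
set t := ln n%:R; have t0 : 0 <= t by exact: arith_ln_ge0.
have -> : (n%:R `^ (2 + h))^-1 = n%:R ^- 2 * expR (- (h * t)).
  rewrite powRD; last by rewrite (gt_eqF n0') implybT.
  by rewrite powR2 invfM /powR (gt_eqF n0') expRN.
have -> : n%:R ^- 2 * expR (- (h * t)) - n%:R ^- 2 + h * (t / n%:R ^+ 2) =
    n%:R ^- 2 * (expR (- (h * t)) - 1 - (- (h * t))).
  by field; rewrite gt_eqF.
rewrite normrM normfV [`|_ ^+ 2|]ger0_norm ?exprn_ge0//.
have sq : Num.sqrt n%:R = expR (t / 2) :> R.
  rewrite -powR12_sqrt ?ltW// /powR gt_eqF//; congr expR; rewrite -/t mulrC.
  by [].
have tb : t ^+ 2 <= 64 * expR (t / 4).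
  have : t <= 8 * expR (t / 8) by have := expR_ge1Dx (t / 8); lra.
  have -> : expR (t / 4) = expR (t / 8) ^+ 2.
    by rewrite -expRM_natl; congr expR; field.
  by have := expR_gt0 (t / 8); nra.
have -> : 64 * h ^+ 2 / (n%:R * Num.sqrt n%:R) = n%:R ^- 2 * (h ^+ 2 * (64 * Num.sqrt n%:R)) :> R.
  have s0 : Num.sqrt n%:R != 0 :> R by rewrite gt_eqF// sqrtr_gt0.
  have := sqr_sqrtr (ltW n0'); move: (Num.sqrt n%:R) s0 => s s0 sn.
  by rewrite -sn; field.
rewrite ler_wpM2l ?invr_ge0 ?exprn_ge0//.
apply: le_trans (expR_taylor1 _) _; rewrite sqrrN exprMn -mulrA ler_wpM2l ?sqr_ge0//.
apply: (@le_trans _ _ (64 * expR (t / 4) * expR (t / 4))).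
  rewrite ler_pM ?sqr_ge0 ?expR_ge0// ler_expR normrN normrM (ger0_norm t0) mulrC.
  by rewrite ler_wpM2l.
by rewrite -mulrA -expRD sq; apply/le_of_eq; congr (_ * expR _); field.
Qed.

Lemma inv_sqrt3_telescope n : (0 < n)%N ->
  (n.+1%:R * Num.sqrt n.+1%:R)^-1 <= 2 / Num.sqrt n%:R - 2 / Num.sqrt n.+1%:R :> R.
Proof.
move=> n0; have n0' : 0 < n%:R :> R by rewrite ltr0n.
have n1' : 0 < n.+1%:R :> R by rewrite ltr0n.
have p0 : 0 < Num.sqrt n%:R :> R by rewrite sqrtr_gt0.
have q0 : 0 < Num.sqrt n.+1%:R :> R by rewrite sqrtr_gt0.
have := sqr_sqrtr (ltW n0'); have := sqr_sqrtr (ltW n1').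
move: (Num.sqrt n%:R) (Num.sqrt n.+1%:R) p0 q0 => p q p0 q0 qn pn.
have e : q ^+ 2 = p ^+ 2 + 1 by rewrite qn pn natr1.
rewrite -qn -subr_ge0.
have -> : 2 / p - 2 / q - (q ^+ 2 * q)^-1 = (2 * q ^+ 2 * (q - p) - p) / (p * q ^+ 3).
  by field; rewrite !gt_eqF.
have pq : p <= q by nra.
rewrite divr_ge0//; last by rewrite mulr_ge0 ?exprn_ge0 ?ltW.
have : (q - p) * (q + p) = 1 by rewrite -subr_sqr e; ring.
nra.
Qed.

(** Summing the remainders gives [|zeta (2+h) - zeta 2 + h Z| <= 128 h^2], which determines the
    limit of the difference quotient. *)
Lemma dzeta2E (Z : R) :
  \sum_(1 <= n < N.+1) arith_ln R n / n%:R ^+ 2 @[N --> \oo] --> Z ->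
  dzeta (2 : R) = - Z.
Proof.
move=> HZ.
have [F FF _] := @dseries2_bounded (fun=> 1) 1 (fun _ _ => le_of_eq (normr1 R)).
have z2 : zeta 2 = F.
  apply: zeta_cvg.
  by under eq_fun do under eq_bigr do rewrite powR2 -[_^-1]mul1r.
have key h : `|h| <= 4^-1 -> `|zeta (2 + h) - zeta 2 + h * Z| <= 128 * h ^+ 2.
  move=> h4.
  pose r n : R := (n%:R `^ (2 + h))^-1 - n%:R ^- 2 + h * (ln n%:R / n%:R ^+ 2).
  have step n : (0 < n)%N -> `|\sum_(1 <= m < n.+2) r m - \sum_(1 <= m < n.+1) r m|
      <= 128 * h ^+ 2 / Num.sqrt n%:R - 128 * h ^+ 2 / Num.sqrt n.+1%:R.
    move=> n0; rewrite big_nat_recr//= addrAC subrr add0r.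
    apply: le_trans (zeta_remainder_bound h4 _) _ => //.
    have := inv_sqrt3_telescope n0; have : 0 <= 64 * h ^+ 2 by rewrite mulr_ge0 ?sqr_ge0.
    move=> c0 /(ler_wpM2l c0) /le_trans; apply.
    by apply/le_of_eq; ring.
  have [l la Hl] := cvg_telescope step (cvg_inv_sqrt _).
  have zh : zeta (2 + h) = l + F - h * Z.
    apply: zeta_cvg.
    rewrite (_ : (fun N => _) = (fun N => \sum_(1 <= n < N.+1) r n +
       \sum_(1 <= n < N.+1) 1 / n%:R ^+ 2
       - h * \sum_(1 <= n < N.+1) arith_ln R n / n%:R ^+ 2)).
      apply: cvgB; first exact: cvgD.
      exact: cvgMl_tmp.
    apply/funext => N; rewrite mulr_sumr -big_split -sumrB; apply: eq_bigr => n _.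
    by rewrite /r /arith_ln /= mul1r; ring.
  rewrite zh z2 (_ : _ - _ + _ = l); last by ring.
  (* The term [n = 1] of the remainder vanishes, so the tail bound at index 1 bounds the whole
     sum. *)
  have := Hl 1%N isT; rewrite big_nat1 /r powR1 ln1 sqrtr1 !(mul0r, mulr0, addr0).
  by rewrite expr1n invr1 subrr sub0r normrN mulr1.
rewrite /dzeta derive1E; apply/cvg_lim => //.
apply/cvgrPdist_le => e e0.
near=> h.
have h0 : h != 0 by near: h; exact: nbhs_dnbhs_neq.
have h4 : `|h| <= 4^-1.
  near: h; apply: dnbhs0_le; lra.
have he : `|h| <= e / 128.
  near: h; apply: dnbhs0_le; rewrite divr_gt0//.
have := key h h4; rewrite /= /GRing.scale/= mulr1 [2 + h]addrC => K.
rewrite -normrN (_ : - _ = h^-1 * (zeta (h + 2) - zeta 2 + h * Z)); last by field.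
rewrite normrM normfV ler_pdivrMl ?normr_gt0//; apply: le_trans K _.
rewrite -(real_normK (num_real h)) expr2 mulrCA ler_wpM2l//.
by rewrite mulrC -ler_pdivlMr.
Unshelve. all: end_near. Qed.

Lemma dseries2_dzeta : dseries2 1 (@arith_ln R) (- dzeta (2 : R)).
Proof.
have [n _|Z HZ H] := @dseries2_ln_bounded (@arith_ln R).
  by rewrite ger0_norm ?arith_ln_ge0.
by rewrite (dzeta2E HZ) opprK.
Qed.

Lemma zeta3_gt0 : 0 < zeta (3 : R).
Proof.
have b n : (0 < n)%N -> `|n%:R^-1| <= 1 :> R.
  by move=> n0; rewrite ger0_norm ?invr_ge0// invf_le1 ?ler1n// ltr0n.
have [F FF _] := dseries2_bounded b.
have eF : (fun N => \sum_(1 <= n < N.+1) n%:R^-1 / n%:R ^+ 2 : R) =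
          (fun N => \sum_(1 <= n < N.+1) (n%:R `^ 3)^-1).
  apply/funext => N; apply: eq_bigr => n _.
  by rewrite powR_mulrn// -invfM -exprS.
rewrite (@zeta_cvg 3 F) -?eF//.
apply: (@lt_le_trans _ _ 1) => //.
rewrite -(cvg_lim _ FF)//; apply: limr_ge; first by apply/cvg_ex; exists F.
near=> N; have N0 : (0 < N)%N by near: N; exists 1%N.
rewrite big_ltn// expr1n invr1 mulr1 lerDl; apply: sumr_ge0 => n _.
by rewrite divr_ge0 ?invr_ge0 ?exprn_ge0.
Unshelve. all: end_near. Qed.

End Zeta.

(** * The logarithmic divisor sum *)

Section DivisorLogSum.
Variable R : realType.
Implicit Types (x y z e : R) (n N M : nat).

Definition ln_sqrt2pi : R := ln (Num.sqrt (2 * pi)).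

Lemma stirling_bounds n : (0 < n)%N ->
  0 <= stirling_seq R n - ln_sqrt2pi <= 4^-1 / n%:R.
Proof.
have [c _ H] := stirling_seq_cvg R.
by rewrite /ln_sqrt2pi -(stirling_constant H); exact: H.
Qed.

(** The last two bounds say [ln (1 + e) = 2 e / (2 + e) + O(e^3)], the precision that the hyperbola
    method needs; they are the Pade and trapezoid bounds at [1 + e]. *)
Lemma ln1D_bounds e : 0 <= e ->
  [/\ 0 <= ln (1 + e), ln (1 + e) <= e, e - ln (1 + e) <= e ^+ 2 / 2,
      2 * e <= (2 + e) * ln (1 + e) & (2 + e) * ln (1 + e) <= 2 * e + e ^+ 3 / 2].
Proof.
move=> e0; have e1 : 1 <= 1 + e by lra.
have h1 : ln (1 + e) <= e by apply: le_ln1Dx; lra.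
have h2 : 2 * e <= (2 + e) * ln (1 + e).
  have := ln_ge_pade e1; rewrite ler_pdivrMr; last by lra.
  by move: (ln (1 + e)) => t; lra.
have h3 : (2 + e) * ln (1 + e) <= 2 * e + e ^+ 3 / 2.
  have e2 : 0 <= 2 + e by lra.
  have := ler_wpM2l e2 (ln_le_mid e1); move/le_trans; apply; rewrite -subr_ge0.
  have -> : 2 * e + e ^+ 3 / 2 - (2 + e) * ((1 + e - (1 + e)^-1) / 2) =
     e ^+ 4 / (2 * (1 + e)).
    by field; rewrite gt_eqF//; lra.
  by rewrite divr_ge0 ?exprn_ge0//; lra.
split => //; first exact: ln_ge0.
by move: (ln (1 + e)) h1 h2 => t h1 h2; nra.
Qed.

Lemma summatory_ln_div z : 0 < z ->
  summatory (fun n => ln (z / n%:R)) z =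
  (Num.truncn z)%:R * ln z - ln_fact R (Num.truncn z).
Proof.
move=> z0; rewrite /ln_fact.
transitivity (\sum_(1 <= n < (Num.truncn z).+1) (ln z - ln n%:R)).
  by apply: eq_big_nat => n /andP[n0 _]; rewrite ln_div ?posrE ?ltr0n.
rewrite sumrB; congr (_ - _).
by rewrite sumr_const_nat subn1 mulr_natl.
Qed.

(** The weight vanishes at the edge [n = z], so with [z = n (1 + e)] the fractional part enters
    through [n (e - ln (1 + e))], of order [n e^2 <= 1/n]. An error [1/z] is needed: at [z = y / a]
    it is summed over all [a <= sqrt y]. *)
Lemma summatory_ln_div_asymp z : 1 <= z ->
  `|summatory (fun n => ln (z / n%:R)) z - (z - ln z / 2 - ln_sqrt2pi)| <= 4 / z.
Proof.
move=> z1; have z0 : 0 < z by lra.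
rewrite summatory_ln_div//; have [] := truncn_bounds z1.
have /andP[_] := truncn_itv (ltW z0).
move: (Num.truncn z) => n zn n0 nz z2n; have n0' : 0 < n%:R :> R by rewrite ltr0n.
have -> : ln_fact R n = stirling_seq R n + (n%:R + 2^-1) * ln n%:R - n%:R.
  by rewrite /stirling_seq; ring.
have := stirling_bounds n0; set s := stirling_seq R n.
pose e := z / n%:R - 1.
have zE : z = n%:R * (1 + e) by rewrite /e; field; rewrite gt_eqF.
have e0 : 0 <= e by rewrite /e subr_ge0 ler_pdivlMr ?mul1r.
have ne : n%:R * e <= 1.
  by move: zn; rewrite zE -natr1; lra.
have [t0 te et _ _] := ln1D_bounds e0.
have -> : ln z = ln n%:R + ln (1 + e) by rewrite zE lnM ?posrE//; lra.
move: (ln (1 + e)) t0 te et => t t0 te et.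
rewrite -[4^-1 / _]/(4^-1 * n%:R^-1) => /andP[s0 s1].
rewrite [X in `|X|](_ : _ = n%:R * (t - e) + t / 2 - (s - ln_sqrt2pi)); last first.
  by rewrite zE; field.
have i0 : 0 < n%:R^-1 :> R by rewrite invr_gt0.
have ni : n%:R * n%:R^-1 = 1 :> R by rewrite divff// gt_eqF.
have ei : e <= n%:R^-1 by rewrite -[leRHS]mul1r ler_pdivlMr// mulrC.
have b1 : n%:R * (e - t) <= n%:R^-1 / 2.
  have : n%:R * (e - t) <= n%:R * (e ^+ 2 / 2) by rewrite ler_wpM2l// ltW.
  by move/le_trans; apply; nra.
have b0 : 0 <= n%:R * (e - t) by rewrite mulr_ge0 ?(ltW n0')//; lra.
have : 2 * n%:R^-1 <= 4 / z.
  rewrite ler_pdivlMr// -mulrA mulrC -mulrA -ler_pdivlMl// ; nra.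
apply: le_trans; rewrite ler_norml; nra.
Qed.

(** Since [M < (N+1)^2], at most one factor of a product [a b <= M] exceeds [N], and by symmetry
    pairs with large [a] mirror those with large [b]. The square of side [N] lies within the region
    since [N^2 <= M], and is counted twice. *)
Lemma hyperbola_sum N M (G : nat -> nat -> R) :
  (N * N <= M < N.+1 * N.+1)%N -> (forall a b, G a b = G b a) ->
  \sum_(1 <= a < M.+1) \sum_(1 <= b < (M %/ a).+1) G a b =
  2 * \sum_(1 <= a < N.+1) \sum_(1 <= b < (M %/ a).+1) G a b
  - \sum_(1 <= a < N.+1) \sum_(1 <= b < N.+1) G a b.
Proof.
move=> /andP[NM MN] symG.
have NleM : (N <= M)%N by nia.
have divE a : (0 < a <= N)%N -> \sum_(1 <= b < (M %/ a).+1) G a b =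
    \sum_(1 <= b < N.+1) G a b + \sum_(N.+1 <= b < M.+1 | (a * b <= M)%N) G a b.
  move=> /andP[a0 aN]; have Na : (N <= M %/ a)%N by rewrite leq_divRL//; nia.
  rewrite (@big_cat_nat _ _ _ N.+1)//=; congr (_ + _).
  have le : ((M %/ a).+1 <= M.+1)%N by rewrite ltnS leq_div.
  rewrite [RHS](@big_cat_nat _ _ _ (M %/ a).+1)//=.
  rewrite [X in _ = _ + X]big1_seq ?addr0; last first.
    move=> b /andP[bM]; rewrite mem_index_iota => /andP[+ _].
    by rewrite ltnNge leq_divRL// mulnC bM.
  rewrite [RHS]big_nat_cond [LHS]big_nat_cond; apply: eq_bigl => b.
  by rewrite andbT ltnS leq_divRL// mulnC -andbA andbb.
rewrite (@big_cat_nat _ _ _ N.+1)//=.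
have -> : \sum_(N.+1 <= a < M.+1) \sum_(1 <= b < (M %/ a).+1) G a b =
    \sum_(1 <= a < N.+1) \sum_(N.+1 <= b < M.+1 | (a * b <= M)%N) G a b.
  transitivity (\sum_(N.+1 <= a < M.+1) \sum_(1 <= b < N.+1)
      (if (b * a <= M)%N then G b a else 0)).
    apply: eq_big_nat => a /andP[Na aM]; rewrite -big_mkcond/=.
    have le : ((M %/ a).+1 <= N.+1)%N by rewrite ltnS -ltnS ltn_divLR; nia.
    rewrite [RHS](@big_cat_nat _ _ _ (M %/ a).+1)//=.
    rewrite [X in _ = _ + X]big1_seq ?addr0; last first.
      move=> b /andP[bM]; rewrite mem_index_iota => /andP[+ _].
      by rewrite ltnNge leq_divRL ?bM//; lia.
    rewrite [RHS]big_nat_cond [LHS]big_nat_cond; apply: eq_big => b; last by [].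
    by rewrite andbT ltnS leq_divRL ?(leq_ltn_trans _ Na)// -andbA andbb.
  rewrite exchange_big; apply: eq_bigr => b _; by rewrite -big_mkcond.
have -> : \sum_(1 <= a < N.+1) \sum_(1 <= b < (M %/ a).+1) G a b =
   \sum_(1 <= a < N.+1) \sum_(1 <= b < N.+1) G a b +
   \sum_(1 <= a < N.+1) \sum_(N.+1 <= b < M.+1 | (a * b <= M)%N) G a b.
  by rewrite -big_split; apply: eq_big_nat => a aN; rewrite divE.
ring.
Qed.

(* Written with [t = ln y - 2 ln N] and [e = y / N^2 - 1 = O(1/N)], all terms
   larger than [ln N] cancel up to third order in [e]. *)
Lemma hyperbola_main_term (y N h s c lN t e g ly H lf : R) :
  1 <= N -> y = N ^+ 2 * (1 + e) -> 0 <= e -> N * e <= 3 ->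
  `|h| <= 8^-1 / N ^+ 2 -> 0 <= s - c <= 4^-1 / N -> 0 <= lN ->
  0 <= t -> t <= e -> e - t <= e ^+ 2 / 2 ->
  2 * e <= (2 + e) * t -> (2 + e) * t <= 2 * e + e ^+ 3 / 2 ->
  ly = 2 * lN + t -> H = lN + g + 2^-1 / N + h ->
  lf = s + (N + 2^-1) * lN - N ->
  `|2 * (y * H - (N * ly - lf) / 2 - c * N) - (N ^+ 2 * ly - 2 * N * lf)
    - (y * ly + (2 * g - 2) * y)| <= `|c| + 30 + lN.
Proof.
move=> N1 yE e0 Ne hb /andP[s0 s1] lN0 t0 te et1 et2 et3 -> -> ->.
have N0 : 0 < N by lra.
rewrite [X in `|X|](_ : _ = 2 * y * h + (2 * N + 1) * (s - c) + c + lN / 2 +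
   (N ^+ 2 * (2 * e - (2 + e) * t) + N * (e - t))); last first.
  by rewrite yE; field; rewrite gt_eqF.
have b1 : `|2 * y * h| <= 1.
  have y0 : 0 <= 2 * y by rewrite yE mulr_ge0// mulr_ge0 ?sqr_ge0//; lra.
  rewrite normrM (ger0_norm y0).
  have : 2 * y * `|h| <= 2 * y * (8^-1 / N ^+ 2) by rewrite ler_wpM2l.
  move/le_trans; apply; rewrite yE.
  have -> : 2 * (N ^+ 2 * (1 + e)) * (8^-1 / N ^+ 2) = (1 + e) / 4.
    by field; rewrite gt_eqF.
  have e3 : e <= 3 by nra.
  lra.
have b2 : 0 <= (2 * N + 1) * (s - c) <= 1.
  rewrite mulr_ge0//=; last by lra.
  have : (2 * N + 1) * (s - c) <= (2 * N + 1) * (4^-1 / N) by rewrite ler_wpM2l//; lra.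
  move/le_trans; apply.
  have -> : (2 * N + 1) * (4^-1 / N) = 2^-1 + 4^-1 / N by field; rewrite gt_eqF.
  have : N^-1 <= 1 by rewrite invf_le1.
  lra.
have b3 : 0 <= N * (e - t) <= 9 / 2.
  rewrite mulr_ge0 ?(ltW N0) ?subr_ge0//=.
  have : N * (e - t) <= N * (e ^+ 2 / 2) by rewrite ler_wpM2l// ltW.
  move/le_trans; apply; have : e <= 3 by nra.
  nra.
have b4 : 0 <= N ^+ 2 * ((2 + e) * t - 2 * e) <= 27 / 2.
  rewrite mulr_ge0 ?sqr_ge0 ?subr_ge0//=.
  have : N ^+ 2 * ((2 + e) * t - 2 * e) <= N ^+ 2 * (e ^+ 3 / 2).
    by rewrite ler_wpM2l ?sqr_ge0//; lra.
  move/le_trans; apply.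
  have -> : N ^+ 2 * (e ^+ 3 / 2) = (N * e) ^+ 2 * e / 2 by field.
  have e3 : e <= 3 by nra.
  have q : (N * e) ^+ 2 <= 9.
    have : 0 <= N * e by rewrite mulr_ge0 ?(ltW N0).
    by move: (N * e) Ne => w; nra.
  by have := sqr_ge0 (N * e); move: ((N * e) ^+ 2) q => w; nra.
have c1 := ler_norm c; have c2 := ler_norm (- c); rewrite normrN in c2.
move: b1 b2 b3 b4; rewrite ler_norml => /andP[? ?] /andP[? ?] /andP[? ?] /andP[? ?].
rewrite ler_norml; apply/andP; split; lra.
Qed.

Lemma summatory_tau_ln y : 0 < y ->
  summatory (fun n => arith_tau R n * ln (y / n%:R)) y =
  \sum_(1 <= a < (Num.truncn y).+1) \sum_(1 <= b < (Num.truncn y %/ a).+1)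
     ln (y / (a * b)%:R).
Proof.
move=> y0; rewrite /summatory.
transitivity (\sum_(1 <= n < (Num.truncn y).+1)
    dirichlet (fun=> 1) (fun=> 1) n * ln (y / n%:R)).
  by apply: eq_big_nat => n /andP[n0 _]; rewrite dirichlet11.
rewrite (sum_dirichletE _ _ _ (fun n => ln (y / n%:R))); apply: eq_bigr => a _.
by rewrite mul1r; apply: eq_bigr => b _; rewrite mul1r.
Qed.

(** In the hyperbola method with [N = floor (sqrt y)], each row sum has error [4 a / y], adding up
    to at most 4, and the sum over the square is an exact expression in [ln_fact]. *)
Lemma summatory_tau_ln_asymp :
  dominated (fun y => summatory (fun n => arith_tau R n * ln (y / n%:R)) y
     - (y * ln y + (2 * euler_gamma - 2) * y)) (fun y => log1 y ^+ 1).
Proof.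
(* The main terms contribute [|ln_sqrt2pi| + 30] and the row errors [2 * 4], rounded up;
   [ln N <= ln y] is absorbed by [log1 y]. *)
exists (`|ln_sqrt2pi| + 40) => [|y y1]; first by rewrite addr_ge0.
have y0 : 0 < y by lra.
have sy0 : 0 < Num.sqrt y by rewrite sqrtr_gt0.
have sy1 : 1 <= Num.sqrt y by rewrite -[leLHS]sqrtr1 ler_wsqrtr.
have syE := sqr_sqrtr (ltW y0).
set M := Num.truncn y; set N := Num.truncn (Num.sqrt y).
have /andP[NleS SltN] : N%:R <= Num.sqrt y < N.+1%:R := truncn_itv (ltW sy0).
have N0 : (0 < N)%N by rewrite truncn_gt0.
have N0' : 0 < N%:R :> R by rewrite ltr0n.
have N1' : 1 <= N%:R :> R by rewrite ler1n.
have NNy : N%:R ^+ 2 <= y by rewrite -syE lerXn2r ?nnegrE// ltW.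
have yNN : y < (N%:R + 1) ^+ 2.
  by rewrite -syE natr1 ltrXn2r ?nnegrE// ltW.
have NM : (N * N <= M < N.+1 * N.+1)%N.
  rewrite truncn_ge_nat ?(ltW y0)// truncn_lt_nat ?(ltW y0)// !natrM.
  by rewrite -expr2 NNy/= -natr1 -expr2.
rewrite summatory_tau_ln// (hyperbola_sum NM); last first.
  by move=> a b; rewrite mulnC.
pose Q z : R := summatory (fun n => ln (z / n%:R)) z.
have aN a : (0 < a < N.+1)%N -> 1 <= y / a%:R.
  move=> /andP[a0 aN]; have a0' : 0 < a%:R :> R by rewrite ltr0n.
  rewrite ler_pdivlMr// mul1r (le_trans _ NNy)// -natrX ler_nat; nia.
have -> : \sum_(1 <= a < N.+1) \sum_(1 <= b < (M %/ a).+1) ln (y / (a * b)%:R) =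
    \sum_(1 <= a < N.+1) Q (y / a%:R).
  apply: eq_big_nat => a /andP[a0 _]; rewrite /Q /summatory truncn_divn ?(ltW y0)//.
  by apply: eq_bigr => b _; rewrite natrM invfM mulrA.
have -> : \sum_(1 <= a < N.+1) \sum_(1 <= b < N.+1) ln (y / (a * b)%:R) =
   N%:R ^+ 2 * ln y - 2 * N%:R * ln_fact R N.
  transitivity (\sum_(1 <= a < N.+1) (N%:R * (ln y - ln a%:R) - ln_fact R N)).
    apply: eq_big_nat => a /andP[a0 _].
    transitivity (\sum_(1 <= b < N.+1) ((ln y - ln a%:R) - ln b%:R)).
      apply: eq_big_nat => b /andP[b0 _].
      by rewrite natrM ln_div ?posrE ?mulr_gt0 ?ltr0n// lnM ?posrE ?ltr0n// opprD addrA.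
    by rewrite sumrB sumr_const_nat subn1 mulr_natl.
  rewrite sumrB sumr_const_nat subn1 -mulr_sumr sumrB sumr_const_nat subn1/=.
  rewrite -/(ln_fact R N) -[ln_fact R N *+ _]mulr_natl -[ln y *+ _]mulr_natl.
  ring.
pose S := \sum_(1 <= a < N.+1) (y / a%:R - ln (y / a%:R) / 2 - ln_sqrt2pi).
have SE : S = y * (\sum_(1 <= a < N.+1) a%:R^-1) - (N%:R * ln y - ln_fact R N) / 2
    - ln_sqrt2pi * N%:R.
  rewrite /S sumrB sumrB -mulr_sumr -mulr_suml sumr_const_nat subn1/= mulr_natr.
  congr (_ - _ / 2 - _).
  rewrite (@eq_big_nat _ _ _ _ _ _ (fun a => ln y - ln a%:R)); last first.
    by move=> a /andP[a0 _]; rewrite ln_div ?posrE ?ltr0n.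
  by rewrite sumrB sumr_const_nat subn1 mulr_natl.
have QS : `|\sum_(1 <= a < N.+1) Q (y / a%:R) - S| <= 4.
  rewrite /S -sumrB; apply: le_trans (ler_norm_sum _ _ _) _.
  apply: (@le_trans _ _ (\sum_(1 <= a < N.+1) (4 * N%:R / y))).
    apply: ler_sum_nat => a aN'; have /andP[a0 aN''] := aN'.
    apply: le_trans (summatory_ln_div_asymp (aN a aN')) _.
    rewrite invfM invrK mulrA [leRHS]mulrAC ler_wpM2l ?divr_ge0 ?(ltW y0)//.
    by rewrite ler_nat.
  rewrite sumr_const_nat subn1/= -[_ *+ N]mulr_natr.
  have -> : 4 * N%:R / y * N%:R = 4 * N%:R ^+ 2 / y by ring.
  by rewrite ler_pdivrMr// ler_wpM2l.
have := harmonic_sum_asymp R N0; have := stirling_bounds N0.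
set h := (X in `|X|) => sb hb.
pose e := y / N%:R ^+ 2 - 1.
have yE : y = N%:R ^+ 2 * (1 + e) by rewrite /e; field; rewrite gt_eqF.
have e0 : 0 <= e by rewrite /e subr_ge0 ler_pdivlMr ?exprn_gt0// mul1r.
(* [y < (N+1)^2] gives [N^2 e < 2 N + 1 <= 3 N]. *)
have Ne : N%:R * e <= 3.
  by move: yNN; rewrite yE; nra.
have [t0 te et1 et2 et3] := ln1D_bounds e0.
have lyE : ln y = 2 * ln N%:R + ln (1 + e).
  have e1 : 0 < 1 + e by lra.
  by rewrite {1}yE lnM ?posrE ?exprn_gt0// lnXn// mulr2n; ring.
have lN0 : 0 <= ln N%:R :> R by exact: ln_ge0.
have hE : \sum_(1 <= k < N.+1) k%:R^-1 = ln N%:R + euler_gamma + 2^-1 / N%:R + h.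
  by rewrite /h; ring.
have lfE : ln_fact R N = stirling_seq R N + (N%:R + 2^-1) * ln N%:R - N%:R.
  by rewrite /stirling_seq; ring.
have := hyperbola_main_term N1' yE e0 Ne hb sb lN0 t0 te et1 et2 et3 lyE hE lfE.
rewrite -SE.
have lNy : ln N%:R <= ln y by rewrite lyE; lra.
move: QS; set q := \sum_(1 <= a < N.+1) Q _ => QS main.
rewrite [X in `|X|](_ : _ = 2 * (q - S) + (2 * S - (N%:R ^+ 2 * ln y - 2 * N%:R * ln_fact R N) -
        (y * ln y + (2 * euler_gamma - 2) * y))); last by ring.
apply: le_trans (ler_normD _ _) _; rewrite normrM [`|2|]ger0_norm//.
have c0 : 0 <= `|ln_sqrt2pi| by [].
rewrite expr1 /log1.
have : `|ln_sqrt2pi| * 1 + 40 + ln y <= (`|ln_sqrt2pi| + 40) * (1 + ln y) by nra.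
apply: le_trans; lra.
Qed.

End DivisorLogSum.

(** * The sum of logarithms weighted by gcds *)

Section GcdLogSum.
Variable R : realType.
Implicit Types (f g u v : nat -> R) (x y F : R) (n m k d q r : nat).

Let one : nat -> R := fun=> 1.
Let id_ : nat -> R := @arith_id R.
Let lnn : nat -> R := @arith_ln R.

(** The [w] of the overview. With [l = k / d], the logarithms of the multiples of [d] up to [k] add
    up to [l (ln k - 1) + w l]. *)
Definition fact_excess n : R := ln_fact R n - n%:R * ln n%:R + n%:R.

(** A divisor [d] of [gcd (k, j)] is a divisor of [k] that divides [j], so exchanging the sums
    leaves, for each [d], the logarithms of the multiples of [d] up to [k]. *)
Lemma gcd_convolution_sum g k : (0 < k)%N ->
  \sum_(1 <= j < k.+1) dirichlet g one (gcdn k j) * ln j%:R =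
  ln k%:R * dirichlet g id_ k - dirichlet g id_ k + dirichlet g fact_excess k.
Proof.
move=> k0.
transitivity (\sum_(d <- divisors k) g d * \sum_(1 <= j < k.+1 | (d %| j)%N) ln j%:R).
  transitivity (\sum_(1 <= j < k.+1) \sum_(1 <= d < k.+1 | (d %| k)%N)
      (if (d %| j)%N then g d * ln j%:R else 0)).
    apply: eq_big_nat => j /andP[j0 _].
    have gk : (0 < gcdn k j <= k)%N.
      by rewrite gcdn_gt0 k0/= dvdn_leq// dvdn_gcdl.
    rewrite /dirichlet (@sum_divisors_widen _ _ k)// mulr_suml -big_mkcondr/=.
    rewrite (eq_bigl (fun d => (d %| k)%N && (d %| j)%N)); last first.
      by move=> d; rewrite dvdn_gcd.
    by apply: eq_bigr => d _; rewrite /one mulr1.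
  rewrite exchange_big/= sum_divisors//; apply: eq_bigr => d _.
  by rewrite -big_mkcond mulr_sumr.
rewrite /dirichlet mulr_sumr -sumrB -big_split/= !big_seq; apply: eq_bigr => d.
rewrite -dvdn_divisors// => dk; have d0 := dvdn_gt0 k0 dk.
have l0 : (0 < k %/ d)%N by rewrite divn_gt0// dvdn_leq.
rewrite sum_multiples//.
have -> : ln k%:R = ln d%:R + ln (k %/ d)%:R :> R.
  by rewrite -{1}(divnK dk) mulnC -lnM ?posrE ?ltr0n// -natrM.
have -> : \sum_(1 <= m < (k %/ d).+1) ln (d * m)%:R =
    (k %/ d)%:R * ln d%:R + ln_fact R (k %/ d).
  rewrite (@eq_big_nat _ _ _ _ _ _ (fun m => ln d%:R + ln m%:R)).
    by rewrite big_split/= sumr_const_nat subn1 mulr_natl.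
  by move=> m /andP[m0 _]; rewrite natrM lnM ?posrE ?ltr0n.
rewrite /id_ /arith_id /fact_excess; ring.
Qed.

Lemma dirichlet_idid n : (0 < n)%N -> dirichlet id_ id_ n = n%:R * arith_tau R n.
Proof.
move=> n0; rewrite -dirichlet11// -dirichlet_natM//.
by apply: eq_dirichlet => // k _; rewrite mulr1.
Qed.

(** At [k = n m] the factor [ln k - 1] equals [ln (x/e) - ln (x / (n m))]: the first part gives the
    divisor sum, the second its logarithmic variant. The divisor function appears because [id * id]
    is [n tau(n)]. *)
Lemma gcd_log_sum_decomp f f0 x : 1 <= x ->
  (forall n, (0 < n)%N -> f0 n = dirichlet (dirichlet f id_) one n) ->
  gcd_log_sum f0 x =
  summatory (fun n => f n / n%:R * (ln (x / expR 1) * summatory (@arith_tau R) (x / n%:R)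
     - summatory (fun m => arith_tau R m * ln (x / n%:R / m%:R)) (x / n%:R))) x +
  summatory (fun n => dirichlet f fact_excess n / n%:R * (Num.truncn (x / n%:R))%:R) x.
Proof.
move=> x1 f0E; have x0 : 0 < x by apply: lt_le_trans x1.
pose g := dirichlet f id_.
transitivity (summatory (fun k => dirichlet f (dirichlet id_ id_) k * ((ln k%:R - 1) / k%:R)) x
   + summatory (fun k => dirichlet (dirichlet f fact_excess) id_ k * k%:R^-1) x).
  rewrite -summatoryD; apply: eq_summatory => k k0 _.
  transitivity (k%:R^-1 * \sum_(1 <= j < k.+1) dirichlet g one (gcdn k j) * ln j%:R).
    congr (_ * _); apply: eq_big_nat => j /andP[j0 _].
    by rewrite f0E// gcdn_gt0 k0.
  rewrite gcd_convolution_sum// dirichletA//.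
  have -> : dirichlet g fact_excess k = dirichlet (dirichlet f fact_excess) id_ k.
    rewrite /g -!dirichletA//; apply: eq_dirichlet => // j j0.
    by rewrite dirichletC.
  by rewrite -/g; ring.
rewrite (summatory_dirichlet f (dirichlet id_ id_)) ?(ltW x0)//.
rewrite (summatory_dirichlet (dirichlet f fact_excess) id_ (fun k => k%:R^-1)) ?(ltW x0)//.
congr (_ + _).
  apply: eq_summatory => n n0 nx; have n0' : 0 < n%:R :> R by rewrite ltr0n.
  rewrite -[RHS]mulrA; congr (_ * _).
  rewrite -summatoryZ -summatoryB -summatoryZ; apply: eq_summatory => m m0 _.
  have m0' : 0 < m%:R :> R by rewrite ltr0n.
  rewrite dirichlet_idid// natrM lnM ?posrE//.
  rewrite !ln_div ?posrE ?divr_gt0 ?expR_gt0// expRK.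
  by field; rewrite !gt_eqF.
apply: eq_summatory => n n0 nx; have n0' : 0 < n%:R :> R by rewrite ltr0n.
rewrite -mulrA; congr (_ * _).
transitivity (summatory (fun=> n%:R^-1 : R) (x / n%:R)).
  apply: eq_summatory => m m0 _; rewrite /id_ /arith_id natrM; field.
  by rewrite !pnatr_eq0 -!lt0n n0.
by rewrite /summatory sumr_const_nat subn1 [RHS]mulr_natr.
Qed.

Definition stirling_delta n : R := stirling_seq R n - ln_sqrt2pi R.

Lemma fact_excessE n :
  fact_excess n = (2^-1 * lnn n + ln_sqrt2pi R * one n) + stirling_delta n.
Proof.
by rewrite /fact_excess /stirling_delta /stirling_seq /lnn /arith_ln /one; ring.
Qed.

Lemma stirling_delta_le n : (0 < n)%N -> `|stirling_delta n| <= n%:R^-1.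
Proof.
move=> n0; have n0' : 0 < n%:R^-1 :> R by rewrite invr_gt0 ltr0n.
have /andP[h1 h2] := stirling_bounds R n0.
by rewrite ger0_norm// (le_trans h2)//; move: (n%:R^-1) n0' => t; lra.
Qed.

(** All terms are nonnegative, so positivity of the value follows from that of the first term, which
    exceeds the second value of [stirling_delta] by [3/2 ln 2 - 1 > 0]. *)
Lemma stirling_delta_series : exists2 T : R, 0 < T & dseries2 0 stirling_delta T.
Proof.
have b n : (0 < n)%N -> `|stirling_delta n| <= 1.
  move=> n0; rewrite (le_trans (stirling_delta_le n0))// invf_le1 ?ler1n//.
  by rewrite ltr0n.
have [T TT H] := dseries2_bounded b; exists T => //.
have d1 : 0 < stirling_delta 1.
  have /andP[d2 _] := stirling_bounds R (isT : (0 < 2)%N).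
  have : stirling_delta 1 = stirling_seq R 2 - ln_sqrt2pi R + (3 / 2 * ln 2 - 1).
    rewrite /stirling_delta /stirling_seq !ln_factS /ln_fact big_nil ln1.
    by field.
  move=> ->; rewrite ltr_wpDl// subr_gt0.
  (* The Pade bound at 2 gives only [ln 2 >= 2/3], an equality case. Splitting [2 = (4/3) (3/2)]
     yields [2/7 + 2/5 = 24/35 > 2/3]. *)
  have h1 : 2 / 7 <= ln (4 / 3) :> R.
    rewrite (_ : 2 / 7 = 2 * (4 / 3 - 1) / (4 / 3 + 1)); last by field.
    by apply: ln_ge_pade; lra.
  have h2 : 2 / 5 <= ln (3 / 2) :> R.
    rewrite (_ : 2 / 5 = 2 * (3 / 2 - 1) / (3 / 2 + 1)); last by field.
    by apply: ln_ge_pade; lra.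
  have -> : ln 2 = ln (4 / 3) + ln (3 / 2) :> R.
    rewrite -lnM ?posrE ?divr_gt0//; congr ln; by field.
  by move: (ln (4 / 3)) (ln (3 / 2)) h1 h2 => a c h1 h2; lra.
apply: (lt_le_trans d1).
rewrite -(cvg_lim _ TT)//; apply: limr_ge; first by apply/cvg_ex; exists T.
near=> N; have N0 : (0 < N)%N by near: N; exists 1%N.
rewrite big_ltn// expr1n divr1 lerDl big_nat_cond; apply: sumr_ge0 => n.
rewrite andbT => /andP[n1 _]; rewrite divr_ge0 ?exprn_ge0//.
by have /andP[] := stirling_bounds R (ltnW n1).
Unshelve. all: end_near. Qed.

Lemma harmonic_bound_stirling_delta : harmonic_bound 0 stirling_delta.
Proof.
have [C C0 H] := @dseries2_zeta R.
exists (`|zeta 2| + C) => [|x x1]; first by rewrite addr_ge0.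
rewrite expr0 mulr1 ger0_norm; last by apply: sumr_ge0 => n _; rewrite divr_ge0.
apply: (@le_trans _ _ (summatory (fun n => 1 / n%:R ^+ 2) x)).
  apply: ler_summatory => n n0 _; rewrite mul1r expr2 invfM.
  by rewrite ler_wpM2r ?invr_ge0// stirling_delta_le.
have := H x x1; rewrite expr0 mul1r => Hx.
have Cx : C / x <= C.
  by rewrite ler_pdivrMr ?ler_peMr//; apply: lt_le_trans x1.
have := ler_norm (zeta 2 : R); move: Hx; rewrite ler_norml => /andP[_].
by move: (summatory _ _) (C / x) Cx => a b Cx h1 h2; lra.
Qed.

(** The harmonic bound for [f * ln] is a separate hypothesis: multiplying those of [f] and [ln]
    would give the exponent [q + 3]. *)
Lemma dirichlet_fact_excess_asymp q f F T : dseries2 q f F ->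
  harmonic_bound q.+1 f -> harmonic_bound q.+2 (dirichlet f lnn) ->
  dseries2 0 stirling_delta T ->
  dominated (fun x => summatory (fun n => dirichlet f fact_excess n / n%:R *
      (Num.truncn (x / n%:R))%:R) x
    - (F * (ln_sqrt2pi R * zeta 2 - dzeta 2 / 2 + T)) * x) (fun x => log1 x ^+ q.+2).
Proof.
move=> hF bF bL hT.
have qle : (q <= q.+2)%N by rewrite -addn2 leq_addr.
have e n : (0 < n)%N -> dirichlet f fact_excess n =
   (2^-1 * dirichlet f lnn n + ln_sqrt2pi R * dirichlet f one n) + dirichlet stirling_delta f n.
  move=> n0; rewrite (@eq_dirichlet _ _ f _ (fun k => (2^-1 * lnn k +
     ln_sqrt2pi R * one k) + stirling_delta k)) => //; last by move=> k _; rewrite fact_excessE.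
  rewrite (dirichletDr f (fun k => 2^-1 * lnn k + ln_sqrt2pi R * one k) stirling_delta).
  rewrite (dirichletDr f (fun k => 2^-1 * lnn k)) !dirichletZr.
  by rewrite [dirichlet stirling_delta f n]dirichletC.
have -> : F * (ln_sqrt2pi R * zeta 2 - dzeta 2 / 2 + T) =
  (2^-1 * (F * - dzeta 2) + ln_sqrt2pi R * (F * zeta 2)) + T * F by ring.
apply: sum_truncn_asymp.
- apply: (@dseries2_ext _ _ (fun n => (2^-1 * dirichlet f lnn n +
     ln_sqrt2pi R * dirichlet f one n) + dirichlet stirling_delta f n)).
    by move=> n n0; rewrite e.
  apply: dseries2D; first apply: dseries2D; first apply: dseries2Z.
  + apply: (@dseries2_dirichlet _ q.+1 1) => //.
    * exact: dseries2_weaken hF.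
    * exact: dseries2_dzeta.
  + apply: dseries2Z; apply: (@dseries2_dirichlet _ q.+1 0) => //.
    * exact: dseries2_weaken hF.
    * exact: dseries2_zeta.
  + apply: (@dseries2_dirichlet _ 0 q) => //.
    * by rewrite addn0.
    * exact: dseries2_weaken hT.
    * exact: harmonic_bound_stirling_delta.
- apply: (@harmonic_bound_le _ _ (fun n => (`|2^-1 * dirichlet f lnn n| +
     `|ln_sqrt2pi R * dirichlet f one n|) + `|dirichlet stirling_delta f n|)).
    by move=> n n0; rewrite e// (le_trans (ler_normD _ _))// lerD2r ler_normD.
  have nb j u : harmonic_bound j u -> harmonic_bound j (fun n => `|u n|).
    apply: dominated_ext => x _; apply: eq_summatory => n _ _.
    by rewrite normr_id.
  apply: harmonic_boundD; first apply: harmonic_boundD; apply: nb.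
  + exact: harmonic_boundZ.
  + apply: harmonic_boundZ; rewrite -addn1; apply: harmonic_bound_dirichlet => //.
    exact: harmonic_bound1.
  + apply: (@harmonic_bound_weaken _ (0 + q.+1)) => //.
    by apply: harmonic_bound_dirichlet => //; exact: harmonic_bound_stirling_delta.
Qed.

Lemma dominated_mulx q f F : dseries2 q f F ->
  dominated (fun x => x * (summatory (fun n => f n / n%:R ^+ 2) x - F))
            (fun x => log1 x ^+ q).
Proof.
move=> [C C0 H]; exists C => // x x1; have x0 : 0 < x by apply: lt_le_trans x1.
rewrite normrM gtr0_norm// mulrC -ler_pdivlMr// -mulrA; exact: H.
Qed.

(** The main terms of [D] and [P] leave the truncated series of [f] times a quadratic in [ln x], and
    that of [f ln] times a linear one. Their rates [q] and [q + 1], with these factors, and the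
    error of [P] summed against [|f n| / n] all give [q + 2]. *)
Lemma gcd_log_sum_asymp q f f0 F F' T :
  (forall n, (0 < n)%N -> f0 n = dirichlet (dirichlet f id_) one n) ->
  dseries2 q f F -> dseries2 q.+1 (fun n => f n * lnn n) F' ->
  harmonic_bound q.+1 f -> harmonic_bound q.+2 (dirichlet f lnn) ->
  dseries2 0 stirling_delta T ->
  dominated (fun x => gcd_log_sum f0 x - (F * x * ln x ^+ 2
     + ((2 * euler_gamma - 3) * F - F') * x * ln x
     + (2 * F' - (4 * euler_gamma - 3) * F
        + F * (ln_sqrt2pi R * zeta 2 - dzeta 2 / 2 + T)) * x
     + summatory (fun n => f n / n%:R * divisor_Delta (x / n%:R) * ln (x / expR 1)) x))
   (fun x => log1 x ^+ q.+2).
Proof.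
move=> f0E hF hF' bF bL hT; set ga := euler_gamma.
pose P y := summatory (fun m => arith_tau R m * ln (y / m%:R)) y
  - (y * ln y + (2 * ga - 2) * y).
pose S x := summatory (fun n => f n / n%:R ^+ 2) x.
pose S' x := summatory (fun n => f n * lnn n / n%:R ^+ 2) x.
pose E x := summatory (fun n => f n / n%:R * P (x / n%:R)) x.
have hE : dominated E (fun x => log1 x ^+ q.+2).
  have [C C0 H] := bF.
  have [D D0 K] : dominated P (fun y => log1 y ^+ 1) := @summatory_tau_ln_asymp R.
  exists (C * D) => [|x x1]; first exact: mulr_ge0.
  apply: le_trans (ler_norm_summatory _ _) _.
  apply: (@le_trans _ _ (summatory (fun n => `|f n| / n%:R * (D * log1 x)) x)).
    apply: ler_summatory => n n0 nx; have /andP[y1 yx] := ge1_divn n0 nx.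
    rewrite !normrM normfV [`|n%:R|]ger0_norm// ler_wpM2l ?divr_ge0//.
    apply: le_trans (K _ y1) _; rewrite expr1 ler_wpM2l// log1_homo//.
    exact: lt_le_trans y1.
  rewrite summatoryZr exprSr mulrACA ler_wpM2r ?mulr_ge0 ?log1_ge0//.
  exact: le_trans (ler_norm _) (H x x1).
apply: (@dominated_ext _ (fun x =>
  (((ln x - 1) * (ln x + (2 * ga - 1)) - (ln x + (2 * ga - 2))) * (x * (S x - F))
   - (ln x - 2) * (x * (S' x - F'))) - E x
  + (summatory (fun n => dirichlet f fact_excess n / n%:R *
      (Num.truncn (x / n%:R))%:R) x
    - (F * (ln_sqrt2pi R * zeta 2 - dzeta 2 / 2 + T)) * x))).
  move=> x x1; have x0 : 0 < x by apply: lt_le_trans x1.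
  rewrite (gcd_log_sum_decomp x1 f0E).
  set B := summatory (fun n => dirichlet f fact_excess n / n%:R * _) x.
  have l1 : ln (x / expR 1) = ln x - 1 by rewrite ln_div ?posrE ?expR_gt0// expRK.
  rewrite l1.
  set A := summatory _ x; set Dl := summatory (fun n => f n / n%:R * _ * _) x.
  (* Expanding [ln (x/n) = ln x - ln n], the coefficient of [ln n] is [-(ln x - 2)], and the rest is
     [(ln x)^2 + (2 ga - 3) ln x - (4 ga - 3)]. *)
  have AE : A = Dl + (((ln x - 1) * (ln x + (2 * ga - 1)) - (ln x + (2 * ga - 2))) * x * S x
      - (ln x - 2) * x * S' x) - E x.
    rewrite /A /Dl /S /S' /E -!summatoryZ -summatoryB -summatoryD -summatoryB.
    apply: eq_summatory => n n0 _; have n0' : 0 < n%:R :> R by rewrite ltr0n.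
    have -> : summatory (@arith_tau R) (x / n%:R) = divisor_Delta (x / n%:R) +
        (x / n%:R * ln (x / n%:R) + (2 * ga - 1) * (x / n%:R)).
      by rewrite /divisor_Delta subrK.
    have -> : summatory (fun m => arith_tau R m * ln (x / n%:R / m%:R)) (x / n%:R) =
        P (x / n%:R) + (x / n%:R * ln (x / n%:R) + (2 * ga - 2) * (x / n%:R)).
      by rewrite /P subrK.
    rewrite /lnn /arith_ln ln_div ?posrE//.
    by field; rewrite gt_eqF.
  rewrite AE; ring.
apply: dominatedD; last exact: dirichlet_fact_excess_asymp.
apply: dominatedB => //; apply: dominatedB.
- rewrite (_ : (fun x => log1 x ^+ q.+2) = (fun x => log1 x ^+ 2 * log1 x ^+ q)); last first.
    by apply/funext => x; rewrite -exprD.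
  apply: dominatedM; last exact: dominated_mulx.
  apply: dominatedB.
    rewrite (_ : (fun x => log1 x ^+ 2) = (fun x => log1 x ^+ 1 * log1 x ^+ 1)); last first.
      by apply/funext => x; rewrite -exprD.
    apply: dominatedM.
      by apply: dominatedB; [exact: dominated_ln|exact: dominated_cst].
    by apply: dominatedD; [exact: dominated_ln|exact: dominated_cst].
  apply: (@dominated_le _ _ (fun x => log1 x ^+ 1)).
    by move=> x x1; apply: log1_exprn_le.
  by apply: dominatedD; [exact: dominated_ln|exact: dominated_cst].
- rewrite (_ : (fun x => log1 x ^+ q.+2) = (fun x => log1 x ^+ 1 * log1 x ^+ q.+1)); last first.
    by apply/funext => x; rewrite -exprD.
  apply: dominatedM; last exact: dominated_mulx.
  by apply: dominatedB; [exact: dominated_ln|exact: dominated_cst].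
Qed.

(** [ln n = ln d + ln (n/d)] makes multiplication by [ln] a derivation, the arithmetic counterpart
    of differentiating a Dirichlet series. *)
Lemma dirichlet_ln_derivation u v n : (0 < n)%N ->
  dirichlet u v n * lnn n =
  dirichlet (fun k => u k * lnn k) v n + dirichlet u (fun k => v k * lnn k) n.
Proof.
move=> n0; rewrite /dirichlet mulr_suml -big_split/= !big_seq; apply: eq_bigr => d.
rewrite -dvdn_divisors// => dn; have d0 := dvdn_gt0 n0 dn.
rewrite -{2}(divnK dn) mulnC /lnn arith_lnM//; first by ring.
by rewrite divn_gt0// dvdn_leq.
Qed.

(** * The series at 2 of the Moebius function, with and without a factor ln *)

Lemma dseries2_0 : dseries2 0 (fun=> 0) (0 : R).
Proof.
exists 0 => // x x1; rewrite mul0r subr0 /summatory big1 ?normr0// => n _.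
by rewrite mul0r.
Qed.

Lemma dseries2_unit : dseries2 0 (dirichlet_unit R) (1 : R).
Proof.
exists 0 => // x x1; rewrite mul0r /summatory big_ltn ?ltnS ?truncn_gt0//.
rewrite big1_seq ?addr0 => [|n].
  by rewrite /dirichlet_unit/= expr1n divr1 subrr normr0.
by rewrite /= mem_index_iota => /andP[n1 _]; rewrite /dirichlet_unit gtn_eqF// mul0r.
Qed.

Let mu := moebius R.

Lemma harmonic_bound_moebius : harmonic_bound 1 mu.
Proof.
apply: harmonic_bound_le (harmonic_bound1 R) => n _; exact: moebius_le1.
Qed.

(** The bound [|mu| <= 1] gives some value [M]; [mu * 1] being the unit forces [M * zeta 2 = 1],
    which also shows [zeta 2 != 0]. *)
Lemma zeta2_neq0_dseries2_moebius :
  zeta 2 != 0 :> R /\ dseries2 0 mu (zeta 2)^-1.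
Proof.
have [M _ HM] := dseries2_bounded (fun n (_ : (0 < n)%N) => moebius_le1 R n).
have Mz : M * zeta 2 = 1.
  apply: (@dseries2_unique _ 1 0 (dirichlet_unit R)); last exact: dseries2_unit.
  apply: dseries2_ext (@dirichlet_moebius1 R) _.
  apply: (@dseries2_dirichlet _ 1 0) => //.
  - exact: dseries2_weaken HM.
  - exact: harmonic_bound_moebius.
  - exact: dseries2_zeta.
have z0 : zeta 2 != 0 :> R.
  by apply/eqP => z0; move/eqP: Mz; rewrite z0 mulr0 eq_sym oner_eq0.
split => //; suff -> : (zeta 2)^-1 = M by [].
by apply: (mulIf z0); rewrite mulVf.
Qed.

(** The derivation applied to [mu * 1] gives [(mu ln) * 1 + mu * ln = 0], because the unit is
    supported at 1, where [ln] vanishes. The value then solves a linear equation. *)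
Lemma dseries2_moebius_ln :
  dseries2 1 (fun n => mu n * lnn n) (dzeta 2 / zeta 2 ^+ 2).
Proof.
have [z0 hM] := zeta2_neq0_dseries2_moebius.
have [|N _ HN] := @dseries2_ln_bounded R (fun n => mu n * lnn n).
  move=> n _; rewrite normrM (ger0_norm (arith_ln_ge0 _ n)) ler_piMl ?arith_ln_ge0//.
  exact: moebius_le1.
suff e : zeta 2 * N + (zeta 2)^-1 * - dzeta 2 = 0.
  suff <- : N = dzeta 2 / zeta 2 ^+ 2 by [].
  apply: (mulfI z0); apply/eqP; rewrite -subr_eq0; apply/eqP; rewrite -e; field.
  exact: z0.
apply: (@dseries2_unique _ 2 0 (fun=> 0)); last exact: dseries2_0.
apply: (@dseries2_ext _ _ (fun n => dirichlet one (fun k => mu k * lnn k) n +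
   dirichlet mu lnn n)).
  move=> n n0; rewrite [dirichlet one _ n]dirichletC//.
  rewrite (@eq_dirichlet _ mu mu lnn (fun k => one k * lnn k))//; last first.
    by move=> k _; rewrite /one mul1r.
  rewrite -dirichlet_ln_derivation// dirichlet_moebius1// /dirichlet_unit.
  by case: eqP => [->|_]; rewrite /lnn /arith_ln ?ln1 ?mulr0 ?mul0r.
apply: dseries2D; apply: (@dseries2_dirichlet _ 1 1) => //.
- exact: dseries2_weaken (@dseries2_zeta R).
- exact: harmonic_bound1.
- exact: dseries2_weaken hM.
- exact: harmonic_bound_moebius.
- exact: dseries2_dzeta.
Qed.

Lemma harmonic_bound_von_mangoldt : harmonic_bound 2 (von_mangoldt R).
Proof.
apply: harmonic_bound_le (@harmonic_bound_arith_ln R) => n n0.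
by rewrite ger0_norm ?von_mangoldt_ge0// von_mangoldt_le.
Qed.

Lemma dominated_bigO r (g : R -> R) : dominated g (fun x : R => log1 x ^+ r) ->
  bigO_pinfty g (fun x : R => ln x ^+ r).
Proof.
move=> [C C0 H]; exists (C * 2 ^+ r); near=> x.
(* Beyond [e] one has [1 + ln x <= 2 ln x], whence the factor [2 ^+ r]. *)
have xe : expR 1 <= x by near: x; apply: nbhs_pinfty_ge; exact: num_real.
have e1 : 1 <= expR 1 :> R by rewrite -expR0 ler_expR.
have x1 : 1 <= x by exact: le_trans xe.
have x0 : 0 < x by exact: lt_le_trans x1.
have l1 : 1 <= ln x by rewrite -(expRK 1) ler_ln ?posrE ?expR_gt0.
apply: le_trans (H x x1) _; rewrite -mulrA ler_wpM2l// normrX -exprMn.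
rewrite ger0_norm; last by lra.
rewrite lerXn2r ?nnegrE ?log1_ge0 /log1//; lra.
Unshelve. all: end_near. Qed.

End GcdLogSum.

Theorem theorem4 (R : realType) :
  exists Theta : R, 0 < Theta /\
  bigO_pinfty
    (fun x : R => gcd_log_sum (@arith_id R) x -
      ((zeta 2)^-1 * x * ln x ^+ 2
       + (zeta 2)^-1 * (2 * euler_gamma - 3 - dzeta 2 / zeta 2)
         * x * ln x
       - (zeta 2)^-1 * (4 * euler_gamma - 3 - 2 * (dzeta 2 / zeta 2)
                        + dzeta 2 / 2 - Theta * zeta 3
                        - zeta 2 * ln (Num.sqrt (2 * pi))) * x
       + summatory (fun n => moebius R n / n%:R * divisor_Delta (x / n%:R)
                             * ln (x / expR 1)) x))
    (fun x : R => ln x ^+ 2)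
  /\
  bigO_pinfty
    (fun x : R => gcd_log_sum (@arith_phi R) x -
      ((zeta 2 ^+ 2)^-1 * x * ln x ^+ 2
       + (zeta 2 ^+ 2)^-1 * (2 * euler_gamma - 3
                             - 2 * (dzeta 2 / zeta 2)) * x * ln x
       - (zeta 2 ^+ 2)^-1 * (4 * euler_gamma - 3
                             - 4 * (dzeta 2 / zeta 2)
                             + dzeta 2 / 2 - Theta * zeta 3
                             - zeta 2 * ln (Num.sqrt (2 * pi))) * x
       + summatory (fun n => dirichlet (moebius R) (moebius R) n / n%:R
                             * divisor_Delta (x / n%:R)
                             * ln (x / expR 1)) x))
    (fun x : R => ln x ^+ 3).
Proof.
have [T T0 hT] := stirling_delta_series R.
have z3 := zeta3_gt0 R; have [z2 hM] := zeta2_neq0_dseries2_moebius R.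
have hMl := dseries2_moebius_ln R; have bM := harmonic_bound_moebius R.
have bL := harmonic_bound_von_mangoldt R.
exists (T / zeta 3); split; first by rewrite divr_gt0.
rewrite divfK ?gt_eqF// -/(ln_sqrt2pi R); split; apply: dominated_bigO.
  (* For [f = mu] the convolution [f * ln] is [von_mangoldt] by definition, so [bL] is the required
     bound. *)
  have := gcd_log_sum_asymp (@arith_id_moebius R) hM hMl bM bL hT.
  apply: dominated_ext => x _; congr (_ - (_ + _)); field.
  exact: z2.
have hMM : dseries2 1 (dirichlet (moebius R) (moebius R)) ((zeta 2)^-1 * (zeta 2)^-1).
  by apply: (@dseries2_dirichlet _ 1 0) => //; exact: dseries2_weaken hM.
have hMMl : dseries2 2 (fun n => dirichlet (moebius R) (moebius R) n * arith_ln R n)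
    ((zeta 2)^-1 * (dzeta 2 / zeta 2 ^+ 2) + (zeta 2)^-1 * (dzeta 2 / zeta 2 ^+ 2)).
  have h : dseries2 2 (dirichlet (moebius R) (fun k => moebius R k * arith_ln R k))
      ((zeta 2)^-1 * (dzeta 2 / zeta 2 ^+ 2)).
    by apply: (@dseries2_dirichlet _ 1 1) => //; exact: dseries2_weaken hM.
  (* The two terms of the product rule agree by commutativity. *)
  apply: dseries2_ext (dseries2D h h) => n n0.
  rewrite dirichlet_ln_derivation//; congr (_ + _); exact: dirichletC.
have bMM : harmonic_bound 2 (dirichlet (moebius R) (moebius R)).
  exact: (@harmonic_bound_dirichlet _ 1 1).
have bMML : harmonic_bound 3 (dirichlet (dirichlet (moebius R) (moebius R)) (@arith_ln R)).
  (* Reassociating [(mu * mu) * ln] as [mu * von_mangoldt] gives the exponent [1 + 2] instead of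
     [2 + 2]. *)
  apply: (@harmonic_bound_le _ _ (fun n => `|dirichlet (moebius R) (von_mangoldt R) n|)).
    by move=> n n0; rewrite -dirichletA.
  have [C C0 H] := harmonic_bound_dirichlet bM bL.
  exists C => // x x1; apply: le_trans (H x x1).
  by apply/le_of_eq; congr `|_|; apply: eq_summatory => n _ _; rewrite normr_id.
have := gcd_log_sum_asymp (@arith_phi_moebius R) hMM hMMl bMM bMML hT.
apply: dominated_ext => x _; congr (_ - (_ + _)); field.
exact: z2.
Qed.
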